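(* Consider the unconstrained nonconvex multi-agent problem and the Zeroth-order Feedback Optimization (ZFO) algorithm described in the context. Suppose $\sigma=0$ (noiseless observations), and let $\epsilon>0$ be sufficiently small. If the algorithm's parameters satisfy $$\eta\leq\frac{\epsilon}{48LG^2\bar b\sqrt{n}\,d},\qquad u\leq\frac{\sqrt{\epsilon}}{4L\sqrt{d}},\qquad T-B+1\geq\left\lceil\frac{6}{\eta\epsilon}\max\{f(x(0))-f^\ast,1\}\right\rceil,$$ then $$\frac{1}{T-B+1}\sum_{t=B}^{T}\mathbb{E}\left[\|\nabla f(x(t))\|^2\right]\leq\epsilon .$$ Moreover, if all the conditions on the parameters are satisfied with equality, then $T=\Theta\left(\dfrac{\bar b\sqrt{n}\,d}{\epsilon^2}\right)$.
   Context: Problem (unconstrained nonconvex setting). There are $n$ agents; agent $i$ has an action $x^i\in\mathbb{R}^{d_i}$, $d=\sum_id_i$, $x=(x^1,\ldots,x^n)\in\mathbb{R}^d$. Each local cost $f_i:\mathbb{R}^d\to\mathbb{R}$ is $G$-Lipschitz and $L$-smooth ($|f_i(x)-f_i(y)|\le G\|x-y\|$, $\|\nabla f_i(x)-\nabla f_i(y)\|\le L\|x-y\|$, $\ell_2$ norms). The objective is $f=\frac1n\sum_{i=1}^nf_i$, possibly nonconvex, and $f^\ast=\inf_{x\in\mathbb{R}^d}f(x)>-\infty$. ZFO algorithm (unconstrained). Parameters: step size $\eta>0$, smoothing radius $u>0$, number of iterations $T\ge B$, an initial action profile $x(0)\in\mathbb{R}^d$. The agents are joined by a communication network, a connected undirected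 graph on $\{1,\ldots,n\}$; $b_{ij}$ is the graph distance between $i$ and $j$. At each time $t=0,1,2,\ldots$: (1) each agent $i$ draws $z^i(t)\sim\mathcal{N}(0,I_{d_i})$, afresh at each time and independently across agents; $z(t)=(z^1(t),\ldots,z^n(t))$; (2) agent $i$ observes $\hat f_i^\pm(t)=f_i(x(t)\pm uz(t))+\varepsilon_i^\pm(t)$ and computes $D_i(t)=\frac{\hat f_i^+(t)-\hat f_i^-(t)}{2u}$; the noises $\varepsilon_i^\pm(t)$ have zero mean and variance at most $\sigma^2$, and are independent of each other and of the action profile; (3) agent $i$ keeps for every $j$ a pair $(D^i_j(t),\tau^i_j(t))$, initialised as $(0,-1)$ at time $-1$. It sets $D^i_i(t)=D_i(t)$, $\tau^i_i(t)=t$; for $j\ne i$ it adopts, among the pairs concerning $j$ received at time $t$ from its neighbours (its own previous pair standing in for a neighbour from which nothing arrives), the one with the largest time stamp; it then sends all its pairs to its neighbours. Thus $D^i_j(t)=D_j(\tau^i_j(t))$, with the convention $D_j(s)=0$, $z(s)=0$ for $s<0$. It forms $G^i(t)=\frac1n\sum_{j=1}^nD^i_j(t)\,z^i(\tau^i_j(t))$; $G(t)=(G^1(t),\ldots,G^n(t))$; (4) $x(t+1)=x(t)-\eta G(t)$. Delays. There is $\Delta\ge0$ with $t-\tau^i_j(t)\le b_{ij}+\Delta$ for all $t\ge0$ and all $i,j$. Define $$\bar b=\left(\frac{\sum_{i,j=1}^n(b_{ij}+\Delta)^2}{n^2}\right)^{1/2},\qquad B=\max_{i,j}b_{ij}+\Delta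 .$$ *)

(* Defs.v *)
From HB Require Import structures.
From mathcomp Require Export all_boot all_order all_algebra.
From mathcomp Require Export all_classical all_reals all_analysis.

Set Implicit Arguments.
Unset Strict Implicit.
Unset Printing Implicit Defensive.

Export Order.TTheory GRing.Theory Num.Theory.
Export numFieldNormedType.Exports.

Local Open Scope classical_set_scope.
Local Open Scope ring_scope.

(* The canonical norm of 'rV[R]_d is the sup norm, hence a separate l2 norm.
   Both induce the same topology, so [differentiable] is the usual notion. *)
Definition norm2 (R : realType) (d : nat) (x : 'rV[R]_d) : R :=
  Num.sqrt (\sum_(k < d) x ord0 k ^+ 2).

Definition grad (R : realType) (d : nat) (g : 'rV[R]_d -> R) (x : 'rV[R]_d) :
    'rV[R]_d :=
  \row_(k < d) 'D_(delta_mx ord0 k) g x.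

Definition lipschitz2 (R : realType) (d : nat) (G : R) (g : 'rV[R]_d -> R) :
    Prop :=
  forall x y, `|g x - g y| <= G * norm2 (x - y).

Definition smooth2 (R : realType) (d : nat) (L : R) (g : 'rV[R]_d -> R) :
    Prop :=
  (forall x, differentiable g x) /\
  (forall x y, norm2 (grad g x - grad g y) <= L * norm2 (x - y)).

Definition objective (R : realType) (n d : nat) (f : 'I_n -> 'rV[R]_d -> R)
    (x : 'rV[R]_d) : R :=
  n%:R^-1 * \sum_(i < n) f i x.

Definition connected_graph (n : nat) (e : rel 'I_n) : Prop :=
  [/\ symmetric e, irreflexive e & forall i j, connect e i j].

(* Least k < n such that some walk with k edges joins i to j; in a connected
   graph on n vertices such a k exists. *)
Definition gdist (n : nat) (e : rel 'I_n) (i j : 'I_n) : nat :=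
  find (fun k => [exists p : k.-tuple 'I_n, path e i p && (last i p == j)])
       (iota 0 n).

Definition bbar (R : realType) (n : nat) (e : rel 'I_n) (Delta : nat) : R :=
  Num.sqrt ((\sum_(i < n) \sum_(j < n) (gdist e i j + Delta)%:R ^+ 2)
            / n%:R ^+ 2).

Definition Bmax (n : nat) (e : rel 'I_n) (Delta : nat) : nat :=
  ((\max_(i < n) \max_(j < n) gdist e i j) + Delta)%N.

Definition mutually_independent (dsp : measure_display)
    (Omega : measurableType dsp) (R : realType) (P : probability Omega R)
    (I : eqType) (X : I -> {RV P >-> R}) : Prop :=
  forall (s : seq I) (A : I -> set R), uniq s ->
    (forall a, measurable (A a)) ->
    P (\bigcap_(a in [set` s]) (X a @^-1` A a)) =
    (\prod_(a <- s) P (X a @^-1` A a))%E.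

(* All the randomness of the algorithm as one family of real random variables:
   the coordinates of the perturbations z(t), and the observation noises
   (xi true t i for the + observation, xi false t i for the - observation). *)
Definition randomness (dsp : measure_display) (Omega : measurableType dsp)
    (R : realType) (P : probability Omega R) (n d : nat)
    (Z : nat -> 'I_d -> {RV P >-> R})
    (xi : bool -> nat -> 'I_n -> {RV P >-> R})
    (a : (nat * 'I_d) + (bool * nat * 'I_n)) : {RV P >-> R} :=
  match a with
  | inl (t, k) => Z t k
  | inr (s, t, i) => xi s t i
  end.

(* z(s), with the convention z(s) = 0 for s < 0. *)
Definition zvec (R : realType) (Omega : Type) (d : nat)
    (z : nat -> 'I_d -> Omega -> R) (s : int) (w : Omega) : 'rV[R]_d :=
  match s with
  | Posz t => \row_(k < d) z t k w
  | Negz _ => 0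
  end.

(* D_i(t), computed from the two noisy observations. *)
Definition zfo_diff (R : realType) (Omega : Type) (n d : nat)
    (f : 'I_n -> 'rV[R]_d -> R) (u : R) (z : nat -> 'I_d -> Omega -> R)
    (xi : bool -> nat -> 'I_n -> Omega -> R) (x : nat -> Omega -> 'rV[R]_d)
    (t : nat) (i : 'I_n) (w : Omega) : R :=
  ((f i (x t w + u *: zvec z t%:Z w) + xi true t i w)
   - (f i (x t w - u *: zvec z t%:Z w) + xi false t i w)) / (2 * u).

(* D t i j and tau t i j are the components of the pair (D^i_j(t), tau^i_j(t)).
   recv s k t i says that the message sent by agent k at time s reaches agent i
   at time t. zfo_candidate lists the pairs concerning j among which agent i
   chooses at time t: those in the messages arriving from its neighbours, its
   own previous pair standing in for a neighbour from which nothing arrives. *)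
Definition zfo_prev (R : realType) (Omega : Type) (n : nat)
    (D : nat -> 'I_n -> 'I_n -> Omega -> R) (tau : nat -> 'I_n -> 'I_n -> int)
    (t : nat) (i j : 'I_n) : (Omega -> R) * int :=
  if t is t'.+1 then (D t' i j, tau t' i j) else (fun=> 0, -1).

Definition zfo_candidate (R : realType) (Omega : Type) (n : nat)
    (e : rel 'I_n) (recv : nat -> 'I_n -> nat -> 'I_n -> bool)
    (D : nat -> 'I_n -> 'I_n -> Omega -> R) (tau : nat -> 'I_n -> 'I_n -> int)
    (t : nat) (i j : 'I_n) (p : (Omega -> R) * int) : Prop :=
  exists2 k, e i k &
    (exists s, [/\ (s < t)%N, recv s k t i & p = (D s k j, tau s k j)]) \/
    ((forall s, (s < t)%N -> ~~ recv s k t i) /\ p = zfo_prev D tau t i j).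

(* G(t), whose block of agent i is (1/n) sum_j D^i_j(t) z^i(tau^i_j(t)). *)
Definition zfo_dir (R : realType) (Omega : Type) (n : nat) (dim : 'I_n -> nat)
    (z : nat -> 'I_(\sum_(i < n) dim i) -> Omega -> R)
    (D : nat -> 'I_n -> 'I_n -> Omega -> R) (tau : nat -> 'I_n -> 'I_n -> int)
    (t : nat) (w : Omega) : 'rV[R]_(\sum_(i < n) dim i) :=
  \mxrow_(i < n) (n%:R^-1 *: \sum_(j < n)
    (D t i j w *: submxrow (zvec z (tau t i j) w) i)).

(* z^i(t) ~ N(0, I), afresh at each time and independently across agents, means
   that all the scalar coordinates Z t k are independent standard normals. *)
Record zfo_run (dsp : measure_display) (Omega : measurableType dsp)
    (R : realType) (P : probability Omega R)
    (n : nat) (dim : 'I_n -> nat) (e : rel 'I_n)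
    (f : 'I_n -> 'rV[R]_(\sum_(i < n) dim i) -> R)
    (eta u sigma : R) (x0 : 'rV[R]_(\sum_(i < n) dim i))
    (recv : nat -> 'I_n -> nat -> 'I_n -> bool)
    (Z : nat -> 'I_(\sum_(i < n) dim i) -> {RV P >-> R})
    (xi : bool -> nat -> 'I_n -> {RV P >-> R})
    (D : nat -> 'I_n -> 'I_n -> Omega -> R)
    (tau : nat -> 'I_n -> 'I_n -> int)
    (x : nat -> Omega -> 'rV[R]_(\sum_(i < n) dim i)) : Prop := ZfoRun {
  zfo_normal : forall t k (A : set R), measurable A ->
    distribution P (Z t k) A = normal_prob 0 1 A;
  zfo_noise_mean : forall s t i, 'E_P[xi s t i]%E = 0%E;
  zfo_noise_var : forall s t i, ('V_P[xi s t i] <= (sigma ^+ 2)%:E)%E;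
  zfo_indep : mutually_independent (randomness Z xi);
  zfo_init : forall w, x 0%N w = x0;
  zfo_own : forall t i,
    D t i i = zfo_diff f u Z xi x t i /\ tau t i i = t%:Z;
  zfo_adopt : forall t i j, j != i ->
    zfo_candidate e recv D tau t i j (D t i j, tau t i j) /\
    (forall p, zfo_candidate e recv D tau t i j p -> p.2 <= tau t i j);
  zfo_step : forall t w, x t.+1 w = x t w - eta *: zfo_dir Z D tau t w
}.

(* Main.v *)
From HB Require Import structures.
Require Import Defs.
From mathcomp Require Import ring lra zify measurable_realfun.

Set Implicit Arguments.
Unset Strict Implicit.
Unset Printing Implicit Defensive.

Local Open Scope classical_set_scope.
Local Open Scope ring_scope.

(** The noise vanishes almost surely, so the iterates are a deterministic
    function of the perturbations, which we read on the space of paths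
    w : nat * 'I_d -> R under the law of independent standard normals.  That
    law is invariant under resampling one coordinate, which gives Gaussian
    integration by parts E[X w_a] = E[d_a X], and under exchanging the
    perturbations of two times.

    By L-smoothness it suffices to bound E<grad F(x_t), G(t)> from below.  Write
    D_j for the difference quotient of f_j and s for a delayed time tau.
    Linearising D_j, repeated integration by parts gives E[(D_j z_k)^2] <= 4 G^2
    for small u, hence E|x_t - x_s|^2 <= 4 eta^2 (t - s)^2 G^2 d.  Integration
    by parts also turns E[d_k F(x_s) D_j(s) z_k(s)] into
    E[d_k F(x_s) d_k D_j(s)], and exchanging z(s) for the fresh z(t) makes the
    perturbation independent of the delay; only then are x_s and d_k D_j moved
    to x_t, at a cost of order L eta G^2 bbar sqrt(n) d by Young's inequality,
    so that the smoothing bias L^2 u^2 d is paid once and not once per agent.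
    Summing the descent inequality over t gives the bound. *)

(** * Euclidean norm, gradients and smoothness *)

Lemma sum_ord_le (R : numDomainType) (n : nat) (a : 'I_n -> R) (c : R) :
  (forall i, a i <= c) -> \sum_(i < n) a i <= n%:R * c.
Proof.
move=> ac; rewrite mulr_natl -[X in _ <= _ *+ X]card_ord -sumr_const.
by apply: ler_sum => i _.
Qed.

Lemma average_le (R : realFieldType) (n : nat) (a : 'I_n -> R) (c : R) :
  (0 < n)%N -> (forall i, a i <= c) -> n%:R^-1 * \sum_(i < n) a i <= c.
Proof.
by move=> n_gt0 ac; rewrite ler_pdivrMl ?ltr0n//; exact: sum_ord_le.
Qed.

Section euclidean.
Context {R : realType} {d : nat}.
Implicit Types (c : R) (p q x y v : 'rV[R]_d) (g : 'rV[R]_d -> R).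

Definition dot x y : R := \sum_(k < d) x ord0 k * y ord0 k.

Lemma dotC x y : dot x y = dot y x.
Proof. by apply: eq_bigr => k _; rewrite mulrC. Qed.

Lemma dotDl x y v : dot (x + y) v = dot x v + dot y v.
Proof. by rewrite -big_split; apply: eq_bigr => k _; rewrite mxE mulrDl. Qed.

Lemma dotZl c x v : dot (c *: x) v = c * dot x v.
Proof. by rewrite mulr_sumr; apply: eq_bigr => k _; rewrite mxE mulrA. Qed.

Lemma dotNl x v : dot (- x) v = - dot x v.
Proof. by rewrite -scaleN1r dotZl mulN1r. Qed.

Lemma dotBl x y v : dot (x - y) v = dot x v - dot y v.
Proof. by rewrite dotDl dotNl. Qed.

Lemma dotDr x y v : dot v (x + y) = dot v x + dot v y.
Proof. by rewrite !(dotC v) dotDl. Qed.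

Lemma dotZr c x v : dot v (c *: x) = c * dot v x.
Proof. by rewrite !(dotC v) dotZl. Qed.

Lemma dotNr x v : dot v (- x) = - dot v x.
Proof. by rewrite !(dotC v) dotNl. Qed.

Lemma dot_sumr (I : Type) (r : seq I) (P : pred I) (V : I -> 'rV[R]_d) x :
  dot x (\sum_(i <- r | P i) V i) = \sum_(i <- r | P i) dot x (V i).
Proof.
rewrite exchange_big; apply: eq_bigr => k _.
by rewrite summxE mulr_sumr.
Qed.

Lemma dot_delta x k : dot x (delta_mx ord0 k) = x ord0 k.
Proof.
rewrite /dot (bigD1 k)//= big1 ?addr0 ?mxE ?eqxx ?mulr1// => l lk.
by rewrite mxE (negbTE lk) mulr0.
Qed.

Lemma norm2_ge0 x : 0 <= norm2 x. Proof. exact: sqrtr_ge0. Qed.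

Lemma norm2_sqr x : norm2 x ^+ 2 = \sum_(k < d) x ord0 k ^+ 2.
Proof. by rewrite sqr_sqrtr// sumr_ge0// => k _; rewrite sqr_ge0. Qed.

Lemma norm2_sqrE x : norm2 x ^+ 2 = dot x x.
Proof. by rewrite norm2_sqr; apply: eq_bigr => k _; rewrite expr2. Qed.

Lemma norm2D_sqr x y :
  norm2 (x + y) ^+ 2 = norm2 x ^+ 2 + 2 * dot x y + norm2 y ^+ 2.
Proof. by rewrite !norm2_sqrE !dotDl !dotDr (dotC y); ring. Qed.

Lemma norm2Z c x : norm2 (c *: x) = `|c| * norm2 x.
Proof.
rewrite /norm2 -sqrtr_sqr -sqrtrM ?sqr_ge0//; congr Num.sqrt.
by rewrite mulr_sumr; apply: eq_bigr => k _; rewrite mxE exprMn.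
Qed.

Lemma norm2N x : norm2 (- x) = norm2 x.
Proof. by rewrite -scaleN1r norm2Z normrN1 mul1r. Qed.

Lemma norm2_0 : norm2 (0 : 'rV[R]_d) = 0.
Proof. by rewrite -(scale0r 0) norm2Z normr0 mul0r. Qed.

Lemma norm2_eq0 x : norm2 x = 0 -> x = 0.
Proof.
move=> x0; apply/rowP => k; rewrite mxE; apply/eqP; rewrite -sqrf_eq0.
have : norm2 x ^+ 2 == 0 by rewrite x0 expr0n.
rewrite norm2_sqr psumr_eq0 => [/allP/(_ k)|i _]; last exact: sqr_ge0.
by rewrite mem_index_enum => /(_ isT).
Qed.

Lemma norm2_delta k : norm2 (delta_mx ord0 k : 'rV[R]_d) = 1.
Proof.
apply/eqP; rewrite -(@eqrXn2 _ 2) ?norm2_ge0// expr1n norm2_sqrE dot_delta.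
by rewrite mxE !eqxx.
Qed.

Lemma normr_dot_le x y : `|dot x y| <= norm2 x * norm2 y.
Proof.
have [y0|y_neq0] := eqVneq (norm2 y) 0.
  by rewrite (norm2_eq0 y0) -(scale0r 0) dotZr mul0r normr0 mulr_ge0 ?norm2_ge0.
have y_gt0 : 0 < norm2 y ^+ 2 by rewrite exprn_even_gt0.
rewrite -ler_sqr ?nnegrE ?mulr_ge0 ?norm2_ge0// real_normK ?num_real// exprMn.
rewrite -subr_ge0 -(pmulr_rge0 _ y_gt0).
have := sqr_ge0 (norm2 (norm2 y ^+ 2 *: x - dot x y *: y)).
rewrite norm2D_sqr norm2N !norm2Z !exprMn !real_normK ?num_real//.
by rewrite dotNr dotZl dotZr; congr (0 <= _); ring.
Qed.

Lemma dot_young c x y : 0 < c ->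
  - (c / 2 * norm2 x ^+ 2) - (2 * c)^-1 * norm2 y ^+ 2 <= dot x y.
Proof.
move=> c0; have c_neq0 : c != 0 by rewrite gt_eqF.
rewrite -subr_ge0 -(pmulr_rge0 _ (_ : 0 < 2 * c)) ?mulr_gt0//.
have := sqr_ge0 (norm2 (c *: x + y)).
rewrite norm2D_sqr norm2Z exprMn real_normK ?num_real// dotZl.
by congr (0 <= _); field.
Qed.

Lemma dot_perturb_ge c p q x y v : 0 < c ->
  dot p x - c * norm2 (p - q) ^+ 2 - c / 2 * norm2 (y - x) ^+ 2 -
    (2 * c)^-1 * (norm2 v ^+ 2 + norm2 y ^+ 2 + norm2 p ^+ 2) <=
  dot (p - q) v + dot q y.
Proof.
move=> c0; have v_ge := dot_young (p - q) v c0.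
have y_ge := dot_young (- (p - q)) y c0; rewrite norm2N in y_ge.
have x_ge := dot_young (y - x) p c0.
have -> : dot q y = dot p x + dot (y - x) p + dot (- (p - q)) y.
  by rewrite dotC !dotBl dotNl dotBl (dotC x) !(dotC y); ring.
by move: v_ge y_ge x_ge; move: ((2 * c)^-1) => e; lra.
Qed.

Lemma ler_coord_norm2 x k : `|x ord0 k| <= norm2 x.
Proof.
by rewrite -dot_delta (le_trans (normr_dot_le _ _))// norm2_delta mulr1.
Qed.

Lemma sqr_coord_le_norm2 x k : x ord0 k ^+ 2 <= norm2 x ^+ 2.
Proof.
rewrite -[leLHS]real_normK ?num_real// ler_sqr ?nnegrE ?norm2_ge0//.
exact: ler_coord_norm2.
Qed.

Lemma norm2_sqr_le c x : norm2 x <= c -> norm2 x ^+ 2 <= c ^+ 2.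
Proof.
move=> xc; have c0 := le_trans (norm2_ge0 x) xc.
by rewrite ler_sqr ?nnegrE ?norm2_ge0.
Qed.

Lemma norm2D x y : norm2 (x + y) <= norm2 x + norm2 y.
Proof.
rewrite -ler_sqr ?nnegrE ?addr_ge0 ?norm2_ge0// norm2D_sqr sqrrD lerD2r lerD2l.
rewrite -[in leRHS]mulr_natl ler_wpM2l// (le_trans (ler_norm _))//.
exact: normr_dot_le.
Qed.

Lemma norm2_sum (I : Type) (r : seq I) (P : pred I) (V : I -> 'rV[R]_d) :
  norm2 (\sum_(i <- r | P i) V i) <= \sum_(i <- r | P i) norm2 (V i).
Proof.
elim/big_rec2: _ => [|i y z _ yz]; first by rewrite norm2_0.
exact: le_trans (norm2D _ _) (lerD _ _).
Qed.

Lemma norm2_sum_sqr (n : nat) (V : 'I_n -> 'rV[R]_d) :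
  norm2 (\sum_(i < n) V i) ^+ 2 <= n%:R * \sum_(i < n) norm2 (V i) ^+ 2.
Proof.
have -> : n%:R * \sum_(i < n) norm2 (V i) ^+ 2 =
    \sum_(i < n) \sum_(j < n)
      (2^-1 * norm2 (V i) ^+ 2 + 2^-1 * norm2 (V j) ^+ 2).
  under [RHS]eq_bigr do
    rewrite big_split/= sumr_const card_ord -[_ *+ n]mulr_natl -mulr_sumr.
  rewrite big_split/= sumr_const card_ord -[_ *+ n]mulr_natl -!mulr_sumr.
  by field.
rewrite norm2_sqrE dot_sumr; apply: ler_sum => i _.
rewrite dotC dot_sumr; apply: ler_sum => j _.
have := sqr_ge0 (norm2 (V i - V j)).
by rewrite norm2D_sqr norm2N dotNr; lra.
Qed.

Lemma norm2_le_sum x : norm2 x <= \sum_(k < d) `|x ord0 k|.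
Proof.
rewrite {1}(matrix_sum_delta x) big_ord1; apply: le_trans (norm2_sum _ _ _) _.
by apply: ler_sum => k _; rewrite norm2Z norm2_delta mulr1.
Qed.

Lemma norm2_le_normr x : norm2 x <= d%:R * `|x|.
Proof.
rewrite (le_trans (norm2_le_sum x))// sum_ord_le// => k.
rewrite [`|x|]mx_normrE.
exact: (le_bigmax _ (fun i : 'I_1 * 'I_d => `|x i.1 i.2|) (ord0, k)).
Qed.

Lemma lipschitz2_continuous G g : lipschitz2 G g -> continuous g.
Proof.
move=> lg x; apply/(@cvgrPdist_le _ _ _ (nbhs x)) => e e0.
pose C := `|G| * d%:R + 1; have C0 : 0 < C by rewrite ltr_wpDl// mulr_ge0.
near=> y.
have xy : `|x - y| <= e / C.
  by near: y; apply: (@cvgr_dist_le _ _ _ (nbhs x)) => //; exact: divr_gt0.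
rewrite (le_trans (lg x y))//.
rewrite (le_trans (ler_wpM2r (norm2_ge0 _) (ler_norm _)))//.
rewrite (le_trans (ler_wpM2l (normr_ge0 _) (norm2_le_normr _)))// mulrA.
rewrite (le_trans (ler_wpM2l _ xy)) ?mulr_ge0// mulrA ler_pdivrMr//.
by rewrite mulrC ler_wpM2l ?(ltW e0)// lerDl.
Unshelve. all: by end_near. Qed.

Lemma derive_dot_grad g x v :
  differentiable g x -> 'D_v g x = dot (grad g x) v.
Proof.
move=> dg; rewrite deriveE// {1}(matrix_sum_delta v) big_ord1 linear_sum/=.
by apply: eq_bigr => k _; rewrite linearZ/= mxE deriveE// mulrC.
Qed.

Lemma is_derive_line g x v (s : R) : (forall y, differentiable g y) ->
  is_derive s 1 (fun r : R => g (x + r *: v)) (dot (grad g (x + s *: v)) v).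
Proof.
move=> dg; have dv : derivable g (x + s *: v) v by exact: diff_derivable.
have quotientE : (fun h : R => h^-1 *: (g (x + (h *: (1 : R) + s) *: v) -
      g (x + s *: v))) =
    (fun h : R => h^-1 *: (g (h *: v + (x + s *: v)) - g (x + s *: v))).
  apply/funext => h; congr (_ *: (g _ - _)).
  by rewrite [h *: (1 : R)]mulr1 scalerDl addrCA.
rewrite -(derive_dot_grad v (dg _)); apply: DeriveDef.
  by rewrite /derivable /= quotientE.
by rewrite /derive /= quotientE.
Qed.

Lemma norm2_grad_le G g x : 0 <= G -> (forall y, differentiable g y) ->
  lipschitz2 G g -> norm2 (grad g x) <= G.
Proof.
move=> G0 dg lg; set v := grad g x.
have [->//|v0] := eqVneq (norm2 v) 0.
have v1 : 0 < norm2 v by rewrite lt_neqAle eq_sym v0 norm2_ge0.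
rewrite -(ler_pM2r v1) -expr2 norm2_sqrE -derive_dot_grad//.
have dv : derivable g x v by exact: diff_derivable.
apply: limr_le => //; near=> h.
have h0 : h != 0 by near: h; exact: nbhs_dnbhs_neq.
rewrite /= (le_trans (ler_norm _))// normrZ normfV ler_pdivrMl ?normr_gt0//.
by rewrite (le_trans (lg _ _))// addrK norm2Z mulrCA.
Unshelve. all: by end_near. Qed.

Lemma gradN g x :
  (forall y, differentiable g y) -> grad (\- g) x = - grad g x.
Proof.
by move=> dg; apply/rowP => k; rewrite !mxE deriveN//; exact: diff_derivable.
Qed.

Lemma smooth2N L g : smooth2 L g -> smooth2 L (\- g).
Proof.
move=> [dg sg]; split=> [x|x y]; first exact: differentiableN.
by rewrite !gradN// -opprD norm2N.
Qed.

(* The function s |-> g (x + s v) - s <grad g x, v> - L s^2 |v|^2 / 2 has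
   nonpositive derivative on [0, 1]. *)
Lemma smooth2_ub L g x v : smooth2 L g ->
  g (x + v) <= g x + dot (grad g x) v + L / 2 * norm2 v ^+ 2.
Proof.
move=> [dg sg].
pose h (s : R) :=
  g (x + s *: v) - s * dot (grad g x) v - L / 2 * s ^+ 2 * norm2 v ^+ 2.
have dh (s : R) : is_derive s 1 h
    (dot (grad g (x + s *: v) - grad g x) v - L * s * norm2 v ^+ 2).
  have dl := is_derive_line x v s dg.
  apply: is_derive_eq; rewrite dotBl /GRing.scale/=.
  by rewrite !(mulr0, mul0r, mulr1, addr0, add0r); lra.
have h10 : h 1 <= h 0.
  apply: (@ler0_derive1_nincr _ h 0 1) => //.
  - move=> s /[!in_itv]/= /andP[s0 s1]; rewrite derive1E derive_val.
    rewrite subr_le0 (le_trans (ler_norm _))// (le_trans (normr_dot_le _ _))//.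
    rewrite expr2 mulrA ler_wpM2r ?norm2_ge0// (le_trans (sg _ _))//.
    by rewrite addrC addKr norm2Z (ger0_norm (ltW s0)) mulrA.
  - by apply: derivable_within_continuous => s _; exact: ex_derive.
move: h10; rewrite /h scale1r scale0r addr0 expr1n expr0n/=.
by rewrite !(mul0r, mul1r, mulr0, mulr1, subr0); lra.
Qed.

Lemma smooth2_taylor L g x v : smooth2 L g ->
  `|g (x + v) - g x - dot (grad g x) v| <= L / 2 * norm2 v ^+ 2.
Proof.
move=> sg; have ub := smooth2_ub x v sg.
have lb := smooth2_ub x v (smooth2N sg).
rewrite gradN ?dotNl /= in lb; last exact: sg.1.
by rewrite ler_norml; apply/andP; split; lra.
Qed.

Lemma lipschitz2_grad L g k : smooth2 L g ->
  lipschitz2 L (fun x => grad g x ord0 k).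
Proof.
move=> [_ sg] x y; apply: le_trans (sg x y).
by have := ler_coord_norm2 (grad g x - grad g y) k; rewrite !mxE.
Qed.

Lemma continuous_grad L g k :
  smooth2 L g -> continuous (fun x => grad g x ord0 k).
Proof. by move=> /(lipschitz2_grad k)/lipschitz2_continuous. Qed.

Lemma continuous_norm2_grad_sqr L g :
  smooth2 L g -> continuous (fun x => norm2 (grad g x) ^+ 2).
Proof.
move=> sg; under eq_fun do rewrite norm2_sqrE.
apply: continuous_big => [|k _ x]; first exact: add_continuous.
have cgk : continuous (fun x => grad g x ord0 k) by exact: continuous_grad sg.
exact: (continuousM (cgk x) (cgk x)).
Qed.

End euclidean.

Lemma norm2_mean_sqr (R : realType) (n d : nat) (V : 'I_n -> 'rV[R]_d) :
  (0 < n)%N ->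
  norm2 (n%:R^-1 *: \sum_(i < n) V i) ^+ 2 <=
  n%:R^-1 * \sum_(i < n) norm2 (V i) ^+ 2.
Proof.
move=> n_gt0; rewrite norm2Z exprMn real_normK ?num_real// expr2 -mulrA.
by rewrite ler_wpM2l ?invr_ge0// ler_pdivrMl ?ltr0n// norm2_sum_sqr.
Qed.

Section objective.
Context {R : realType} {n d : nat}.
Variables (f : 'I_n -> 'rV[R]_d -> R) (G L : R).
Hypothesis n_gt0 : (0 < n)%N.
Hypothesis lf : forall i, lipschitz2 G (f i).
Hypothesis sf : forall i, smooth2 L (f i).

Let objectiveE : objective f = n%:R^-1 *: \sum_(i < n) f i.
Proof. by apply/funext => y; rewrite /objective fct_sumE. Qed.

Lemma differentiable_objective x : differentiable (objective f) x.
Proof.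
rewrite objectiveE; apply: differentiableZ; apply: differentiable_sum => i.
exact: (sf i).1.
Qed.

Lemma grad_objective x :
  grad (objective f) x = n%:R^-1 *: \sum_(i < n) grad (f i) x.
Proof.
have dfk k i : derivable (f i) x (delta_mx ord0 k).
  by apply: diff_derivable; exact: (sf i).1.
apply/rowP => k; rewrite 2!mxE summxE objectiveE.
rewrite deriveZ ?derive_sum//; last exact: derivable_sum.
by congr (_ * _); apply: eq_bigr => i _; rewrite mxE.
Qed.

Lemma lipschitz2_objective : lipschitz2 G (objective f).
Proof.
move=> x y; rewrite /objective -mulrBr -sumrB normrM ger0_norm ?invr_ge0//.
apply: le_trans (average_le n_gt0 (fun i => lf i x y)).
by rewrite ler_wpM2l ?invr_ge0// ler_norm_sum.
Qed.

Lemma smooth2_objective : smooth2 L (objective f).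
Proof.
split=> [x|x y]; first exact: differentiable_objective.
rewrite !grad_objective -scalerBr -sumrB norm2Z ger0_norm ?invr_ge0//.
apply: le_trans (average_le n_gt0 (fun i => (sf i).2 x y)).
by rewrite ler_wpM2l ?invr_ge0// norm2_sum.
Qed.

End objective.

(** * Integration by parts for the standard normal distribution *)

Section normal_integral.
Context {R : realType} (m s : R).
Local Notation mu := (@lebesgue_measure R).
Local Notation pdf := (normal_pdf m s).
Local Notation normal := (normal_prob m s).

Let normal_dominates := @normal_prob_dominates R m s.

Let ae_eq_Radon_Nikodym_pdf :
  ae_eq mu setT (Radon_Nikodym_SigmaFinite.f normal mu) (EFin \o pdf).
Proof.
apply: integral_ae_eq => //=.
- exact: Radon_Nikodym_SigmaFinite.f_integrable.
- by apply/measurable_EFinP; exact: measurable_normal_pdf.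
- by move=> E _ mE; rewrite -Radon_Nikodym_SigmaFinite.f_integral.
Qed.

Lemma ge0_integral_normal (f : R -> \bar R) : measurable_fun setT f ->
  (forall y, 0 <= f y)%E ->
  (\int[normal]_y f y = \int[mu]_y (f y * (pdf y)%:E))%E.
Proof.
move=> mf f0.
rewrite -(Radon_Nikodym_SigmaFinite.change_of_variables normal_dominates)//.
apply: ae_eq_integral => //.
- apply: emeasurable_funM => //.
  exact: measurable_int (Radon_Nikodym_SigmaFinite.f_integrable _).
- apply: emeasurable_funM => //; apply/measurableT_comp => //.
  exact: measurable_normal_pdf.
- exact: ae_eqe_mul2l.
Qed.

Lemma integrable_normal (f : R -> R) : measurable_fun setT f ->
  mu.-integrable setT (fun y => (f y * pdf y)%:E) ->
  normal.-integrable setT (EFin \o f).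
Proof.
move=> mf /integrableP[_ fi]; apply/integrableP.
split; first exact/measurable_EFinP.
rewrite ge0_integral_normal//=; last by do 2 apply: measurableT_comp => //.
move: fi; congr (_ < _)%E; apply: eq_integral => y _ /=.
by rewrite normrM (ger0_norm (normal_pdf_ge0 _ _ _)).
Qed.

Lemma integral_normal (f : R -> R) : measurable_fun setT f ->
  normal.-integrable setT (EFin \o f) ->
  (\int[normal]_y (f y)%:E = \int[mu]_y (f y * pdf y)%:E)%E.
Proof.
move=> mf fi; rewrite -(Radon_Nikodym_change_of_variables normal_dominates)//.
have RN_pdf := ae_eq_trans (ae_eq_sym
  (ae_eq_Radon_Nikodym_SigmaFinite normal_dominates measurableT))
  ae_eq_Radon_Nikodym_pdf.
under [RHS]eq_integral do rewrite EFinM.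
apply: ae_eq_integral => //.
- by apply: emeasurable_funM => //; exact/measurable_EFinP.
- apply: emeasurable_funM => //; first exact/measurable_EFinP.
  by apply/measurableT_comp => //; exact: measurable_normal_pdf.
- exact: ae_eqe_mul2l.
Qed.

End normal_integral.

Lemma integral_is_derive (R : realType) (F f : R -> R) (l r : R) :
  (forall y : R, is_derive y 1 F (f y)) -> continuous f ->
  (@lebesgue_measure R).-integrable setT (EFin \o f) ->
  F y @[y --> +oo] --> r -> F y @[y --> -oo] --> l ->
  (\int[@lebesgue_measure R]_y (f y)%:E = (r - l)%:E)%E.
Proof.
move=> dF cf fi Fr Fl; set mu := @lebesgue_measure R.
have cF : continuous F.
  move=> y; apply/differentiable_continuous/derivable1_diffP.
  exact: ex_derive.
pose trunc (n : nat) : R -> \bar R := (EFin \o f) \_ `[- n.+1%:R, n.+1%:R].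
have truncE n : (\int[mu]_y trunc n y = (F n.+1%:R - F (- n.+1%:R))%:E)%E.
  rewrite -integral_mkcond (@continuous_FTC2 _ f F) ?EFinB//.
  - by rewrite (@lt_trans _ _ 0)// oppr_lt0.
  - exact: continuous_subspaceT.
  - split; first by move=> y _; exact: ex_derive.
    + by apply: cvg_at_right_filter; exact: cF.
    + by apply: cvg_at_left_filter; exact: cF.
  - by move=> y _; rewrite derive1E derive_val.
have mf : measurable_fun setT (EFin \o f) by case/integrableP: fi.
have [|||||_ _ trunc_cvg] := @dominated_convergence _ _ _ mu setT measurableT
  trunc (EFin \o f) (abse \o (EFin \o f)).
- move=> n; apply/measurable_restrict => //; rewrite setTI.
  exact: measurable_funTS.
- exact: mf.
- apply: aeW => y _; apply: cvg_near_cst; near=> n.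
  rewrite /trunc patchE mem_set//= in_itv/= -ler_norml.
  rewrite (le_trans (ltW (archi_boundP (normr_ge0 y))))// ler_nat ltnW//.
  by near: n; exact: nbhs_infty_gt.
- exact: integrable_abse.
- apply: aeW => y n _; rewrite /trunc patchE; case: ifPn => _ //=.
  by rewrite normr0 lee_fin.
apply: cvg_unique trunc_cvg _ => //; rewrite (funext truncE).
apply: cvg_EFin; first exact: nearW.
have nat_cvgy : (n.+1%:R : R) @[n --> \oo] --> +oo.
  by rewrite (cvg_shiftS (fun n => n%:R : R)); exact: cvgr_idn.
apply: cvgB; first exact: cvg_comp nat_cvgy Fr.
by apply: cvg_comp Fl; exact/cvgNrNy.
Unshelve. all: by end_near. Qed.

Section standard_normal.
Context {R : realType}.
Local Notation mu := (@lebesgue_measure R).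
Local Notation phi := (@normal_pdf R 0 1).
Local Notation gauss := (@normal_prob R 0 1).
Implicit Types (C y : R) (p : nat).

Lemma standard_normal_pdfE y : phi y = normal_peak 1 * expR (- (y ^+ 2) / 2).
Proof.
by rewrite normal_pdfE ?oner_neq0// /normal_fun subr0 expr1n mulr2n.
Qed.

Lemma is_derive_standard_normal_pdf y : is_derive y 1 phi (- y * phi y).
Proof.
rewrite (funext standard_normal_pdfE); apply: is_derive_eq.
by rewrite /GRing.scale/= !(mulr0, mul0r, mulr1, addr0, add0r); lra.
Qed.

Lemma poly_normal_pdf_le p : exists K,
  forall y, (1 + y ^+ 2) ^+ p * phi y <= K * normal_pdf 0 (Num.sqrt 2) y.
Proof.
have sqrt2_neq0 : Num.sqrt 2 != 0 :> R by rewrite gt_eqF// sqrtr_gt0.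
pose K : R := 4 ^+ p * p`!%:R * expR (4^-1) * normal_peak 1 /
  normal_peak (Num.sqrt 2).
exists K => y.
have exp_half :
    expR (- (y ^+ 2) / 2) = expR (- (y ^+ 2) / 4) * expR (- (y ^+ 2) / 4).
  by rewrite -expRD; congr expR; lra.
have pow_le :
    (1 + y ^+ 2) ^+ p <= 4 ^+ p * p`!%:R * expR (4^-1) * expR (y ^+ 2 / 4).
  pose t := (1 + y ^+ 2) / 4.
  rewrite -mulrA -expRD (_ : 4^-1 + y ^+ 2 / 4 = t); last by rewrite /t; lra.
  have t0 : 0 <= t by rewrite divr_ge0// addr_ge0// sqr_ge0.
  have -> : 1 + y ^+ 2 = 4 * t by rewrite /t; lra.
  rewrite exprMn -mulrA ler_wpM2l ?exprn_ge0//.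
  rewrite -ler_pdivrMl ?ltr0n ?fact_gt0// mulrC.
  case: (p) => [|q]; first by rewrite expr0 divr1 -expR0 ler_expR.
  by apply: le_trans (expR_ge1Dxn q t0); rewrite lerDr.
rewrite standard_normal_pdfE normal_pdfE// /normal_fun subr0 sqr_sqrtr//.
rewrite [K * _]mulrA /K divfK ?gt_eqF ?normal_peak_gt0// exp_half.
rewrite (_ : 2 *+ 2 = 4 :> R); last by lra.
rewrite mulrCA -mulrA (mulrCA _ (normal_peak 1)) ler_wpM2l ?normal_peak_ge0//.
rewrite !mulrA ler_wpM2r ?expR_ge0// -ler_pdivlMr ?expR_gt0// -expRN.
by rewrite -mulNr opprK.
Qed.

Lemma normrM_normal_pdf_le C p (f : R -> R) :
  (forall y, `|f y| <= C * (1 + y ^+ 2) ^+ p) ->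
  exists K, forall y, `|f y * phi y| <= K * normal_pdf 0 (Num.sqrt 2) y.
Proof.
move=> fC; have [K polyK] := poly_normal_pdf_le p.
have C0 : 0 <= C.
  by have := le_trans (normr_ge0 _) (fC 0); rewrite expr0n addr0 expr1n mulr1.
exists (C * K) => y; rewrite normrM (ger0_norm (normal_pdf_ge0 _ _ _)).
rewrite (le_trans (ler_wpM2r (normal_pdf_ge0 _ _ _) (fC y)))// -!mulrA.
exact: ler_wpM2l.
Qed.

Lemma integrable_poly_normal_pdf C p (f : R -> R) : measurable_fun setT f ->
  (forall y, `|f y| <= C * (1 + y ^+ 2) ^+ p) ->
  mu.-integrable setT (fun y => (f y * phi y)%:E).
Proof.
move=> mf /normrM_normal_pdf_le[K fK].
apply: (@le_integrable _ _ _ mu setT _ _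
  (fun y => K%:E * (normal_pdf 0 (Num.sqrt 2) y)%:E)%E) => //.
- by apply/measurable_EFinP/measurable_funM => //; exact: measurable_normal_pdf.
- by move=> y _ /=; rewrite lee_fin (le_trans _ (ler_norm _)).
- by apply: integrableZl => //; exact: integrable_normal_pdf.
Qed.

Lemma integrable_poly_normal C p (f : R -> R) : measurable_fun setT f ->
  (forall y, `|f y| <= C * (1 + y ^+ 2) ^+ p) ->
  gauss.-integrable setT (EFin \o f).
Proof.
move=> mf fC; apply: integrable_normal => //.
exact: integrable_poly_normal_pdf fC.
Qed.

Lemma cvg_poly_normal_pdf C p (f : R -> R) :
  (forall y, `|f y| <= C * (1 + y ^+ 2) ^+ p) ->
  f y * phi y @[y --> +oo] --> (0 : R) /\ f y * phi y @[y --> -oo] --> (0 : R).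
Proof.
have pdf_cvg0 : normal_pdf 0 (Num.sqrt 2) y @[y --> +oo] --> (0 : R).
  have pdfE y : normal_pdf 0 (Num.sqrt 2) y =
      normal_peak (Num.sqrt 2) * gauss_fun (y / 2) :> R.
    rewrite normal_pdfE ?gt_eqF ?sqrtr_gt0// /normal_fun subr0 sqr_sqrtr//.
    by congr (_ * expR _); field.
  rewrite (funext pdfE) -(mulr0 (normal_peak (Num.sqrt 2))).
  apply: cvgM; first exact: cvg_cst.
  apply: cvg_comp cvg_gauss_fun; apply: gt0_cvgMly; first by rewrite invr_gt0.
  exact: cvg_id.
have cvgy (g : R -> R) : (forall y, `|g y| <= C * (1 + y ^+ 2) ^+ p) ->
    g y * phi y @[y --> +oo] --> (0 : R).
  move=> /normrM_normal_pdf_le[K gK]; apply: norm_cvg0.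
  apply: (squeeze_cvgr _ (cvg_cst 0)); last first.
    by rewrite -(mulr0 K); apply: cvgM pdf_cvg0; exact: cvg_cst.
  by apply: nearW => y; rewrite normr_ge0 gK.
move=> fC; split; first exact: cvgy.
have phiN y : phi (- y) = phi y by rewrite !standard_normal_pdfE sqrrN.
apply/cvgNy_compNP; rewrite /comp; under eq_fun do rewrite phiN.
by apply: (cvgy (fun y => f (- y))) => y; rewrite -sqrrN.
Qed.

Section stein.
Variables (psi psi' : R -> R) (C : R) (p : nat).
Hypothesis dpsi : forall y : R, is_derive y 1 psi (psi' y).
Hypothesis cpsi' : continuous psi'.
Hypothesis psi_le : forall y, `|psi y| <= C * (1 + y ^+ 2) ^+ p.
Hypothesis psi'_le : forall y, `|psi' y| <= C * (1 + y ^+ 2) ^+ p.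

Let cpsi : continuous psi.
Proof.
by move=> y; apply/differentiable_continuous/derivable1_diffP; exact: ex_derive.
Qed.

Let psiM_le y : `|psi y * y| <= C * (1 + y ^+ 2) ^+ p.+1.
Proof.
rewrite normrM exprSr mulrA ler_pM//.
rewrite -real_normK ?num_real//.
by have := sqr_ge0 (`|y| - 1); have := normr_ge0 y; nra.
Qed.

Let mpsiM : measurable_fun setT (fun y => psi y * y).
Proof. by apply: measurable_funM => //; exact: continuous_measurable_fun. Qed.

Let mpsi' : measurable_fun setT psi'.
Proof. exact: continuous_measurable_fun. Qed.

Let cphi : continuous phi.
Proof. by apply: continuous_normal_pdf; exact: oner_neq0. Qed.

Lemma stein : (\int[gauss]_y (psi y * y)%:E = \int[gauss]_y (psi' y)%:E)%E.
Proof.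
have psi'_int := integrable_poly_normal_pdf mpsi' psi'_le.
have psiM_int := integrable_poly_normal_pdf mpsiM psiM_le.
have [psi_cvgy psi_cvgNy] := cvg_poly_normal_pdf psi_le.
have dF (y : R) : is_derive y 1 (fun y => psi y * phi y)
    (psi' y * phi y - psi y * y * phi y).
  have dphi := is_derive_standard_normal_pdf y; have dpsiy := dpsi y.
  by apply: is_derive_eq; rewrite /GRing.scale/=; lra.
have int0 : (\int[mu]_y (psi' y * phi y - psi y * y * phi y)%:E = 0)%E.
  rewrite (integral_is_derive dF _ _ psi_cvgy psi_cvgNy) ?subrr//.
    move=> y; apply: cvgB; apply: cvgM.
    - exact: cpsi'.
    - exact: cphi.
    - by apply: cvgM; [exact: cpsi|exact: cvg_id].
    - exact: cphi.
  by apply: eq_integrable (integrableB measurableT psi'_int psiM_int).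
rewrite !integral_normal//; last 2 first.
- exact: integrable_poly_normal psiM_le.
- exact: integrable_poly_normal psi'_le.
have := integralB_EFin measurableT psi'_int psiM_int.
rewrite [X in X = _ -> _]int0.
have /fineK <- := integrable_fin_num measurableT psi'_int.
have /fineK <- := integrable_fin_num measurableT psiM_int.
by rewrite -EFinB => -[/esym/subr0_eq ->].
Qed.

End stein.

End standard_normal.

(** * The Gaussian law on paths *)

Section image_law.
Context {d1 d2 : measure_display}.
Context {T : measurableType d1} {S : measurableType d2} {R : realType}.
Variables (m : {measure set T -> \bar R}) (nu : {measure set S -> \bar R}).
Variable phi : T -> S.
Hypothesis mphi : measurable_fun setT phi.
Hypothesis image_law : forall A, measurable A -> nu A = pushforward m phi A.

Let phi_mfun : {mfun T >-> S} :=
  HB.pack phi (isMeasurableFun.Build _ _ _ _ _ mphi).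

Lemma ge0_integral_image_law (f : S -> \bar R) : measurable_fun setT f ->
  (forall y, 0 <= f y)%E -> (\int[nu]_y f y = \int[m]_x f (phi x))%E.
Proof.
move=> mf f0; rewrite (eq_measure_integral (pushforward m phi_mfun)).
  by rewrite ge0_integral_pushforward.
by move=> A mA _; exact: image_law.
Qed.

Lemma integrable_image_law (f : S -> R) :
  nu.-integrable setT (EFin \o f) -> m.-integrable setT (EFin \o (f \o phi)).
Proof.
move=> /integrableP[mf fi]; apply/integrableP.
split; first exact: (measurableT_comp mf mphi).
by move: fi; rewrite ge0_integral_image_law//; exact: measurableT_comp.
Qed.

Lemma integral_image_law (f : S -> R) : nu.-integrable setT (EFin \o f) ->
  (\int[nu]_y (f y)%:E = \int[m]_x (f (phi x))%:E)%E.
Proof.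
move=> fi; rewrite (eq_measure_integral (pushforward m phi_mfun)).
  rewrite integral_pushforward//; last exact: integrable_image_law.
  by case/integrableP: fi.
by move=> A mA _; exact: image_law.
Qed.

End image_law.

Section path_space.
Context {R : realType} {I : eqType}.
Local Notation gauss := (@normal_prob R 0 1).

Definition box (s : seq I) (A : I -> set R) : set (I -> R) :=
  [set w | forall a, a \in s -> A a (w a)].

Definition cylinder : set (set (I -> R)) :=
  [set C | exists s A,
    [/\ uniq s, forall a, measurable (A a) & C = box s A]].

Definition path_space := g_sigma_algebraType cylinder.

Definition gaussian_law (mu : set path_space -> \bar R) :=
  forall s A, uniq s -> (forall a, measurable (A a)) ->
    mu (box s A) = (\prod_(a <- s) gauss (A a))%E.

Lemma measurable_box s A : uniq s -> (forall a, measurable (A a)) ->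
  measurable (box s A : set path_space).
Proof. by move=> us mA; apply: sub_sigma_algebra; exists s, A. Qed.

Lemma cylinder_setI : setI_closed cylinder.
Proof.
move=> _ _ [s [A [us mA ->]]] [t [B [ut mB ->]]].
pose extend (r : seq I) (D : I -> set R) a := if a \in r then D a else setT.
exists (undup (s ++ t)), (fun a => extend s A a `&` extend t B a); split.
- exact: undup_uniq.
- by move=> a; apply: measurableI; rewrite /extend; case: ifP.
- apply/seteqP; split=> [w [Aw Bw] a _|w AB].
    by rewrite /extend; split; case: ifP => // a_in; [exact: Aw|exact: Bw].
  split=> a a_in; have := AB a; rewrite mem_undup mem_cat a_in ?orbT /extend.
    by rewrite a_in => /(_ isT)[].
  by rewrite a_in => /(_ isT)[].
Qed.

Lemma cylinder_setT : cylinder setT.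
Proof. by exists [::], (fun=> setT); split => //; apply/seteqP; split. Qed.

Lemma path_measure_unique (m1 m2 : {measure set path_space -> \bar R}) :
  (m1 setT < +oo)%E -> (forall C, cylinder C -> m1 C = m2 C) ->
  forall A, measurable A -> m1 A = m2 A.
Proof.
move=> m1_fin m12 A mA.
apply: (@measure_unique _ R path_space (cylinder : set (set path_space))
  (fun=> setT)) => //.
- exact: cylinder_setI.
- by move=> _; exact: cylinder_setT.
- by rewrite bigcup_const//; exists 0%N.
Qed.

Lemma measurable_path d (T : measurableType d) (h : T -> path_space) :
  (forall a, measurable_fun setT (fun x => h x a)) -> measurable_fun setT h.
Proof.
move=> mh; apply: (@measurability _ _ T path_space setT h
  (cylinder : set (set path_space))) => // _ [_ [s [A [us mA ->]]] <-].
rewrite setTI (_ : _ @^-1` _ =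
    \bigcap_(a in [set` s]) ((fun x => h x a) @^-1` A a))//.
apply: fin_bigcap_measurable => [|a _]; first exact: finite_seq.
by rewrite -[X in measurable X]setTI; exact: mh.
Qed.

Lemma measurable_path_coord a :
  measurable_fun setT (fun w : path_space => w a).
Proof.
move=> _ A mA; rewrite setTI (_ : _ @^-1` _ = box [:: a] (fun=> A)).
  exact: measurable_box.
apply/seteqP; split=> [w Aw b|w]; first by rewrite inE => /eqP ->.
by apply; rewrite inE.
Qed.

Definition upd (w : path_space) (a : I) (y : R) : path_space :=
  [eta w with a |-> y].

Lemma upd_same w a y : upd w a y a = y. Proof. by rewrite /upd/= eqxx. Qed.

Lemma upd_other w a y b : b != a -> upd w a y b = w b.
Proof. by move=> ba; rewrite /upd/= (negbTE ba). Qed.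

Lemma measurable_upd a :
  measurable_fun setT (fun p : path_space * R => upd p.1 a p.2).
Proof.
apply: measurable_path => b; rewrite /upd/=; case: (b == a).
  exact: measurable_snd.
exact: (measurableT_comp (measurable_path_coord b) measurable_fst).
Qed.

Lemma measurable_reindex (p : I -> I) :
  measurable_fun setT (fun w : path_space => (w \o p : path_space)).
Proof. by apply: measurable_path => a; exact: measurable_path_coord. Qed.

Lemma preimage_upd_box s A a : uniq s ->
  (fun p : path_space * R => upd p.1 a p.2) @^-1` box s A =
  box (rem a s) A `*` (if a \in s then A a else setT).
Proof.
move=> us; apply/seteqP; split=> [[w y] sA|[w y] [/= sA Ay] b bs].
  split=> [b|]; last by case: ifP => // /sA; rewrite /= upd_same.
  by rewrite mem_rem_uniq// inE => /andP[ba /sA]; rewrite /= upd_other.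
have [ba|ba] := eqVneq b a; first by move: Ay; rewrite -ba bs /= upd_same.
by rewrite /= upd_other//; apply: sA; rewrite mem_rem_uniq// inE ba.
Qed.

Lemma preimage_reindex_box s A (p : I -> I) : involutive p ->
  (fun w : path_space => (w \o p : path_space)) @^-1` box s A =
  box (map p s) (A \o p).
Proof.
move=> pK; apply/seteqP; split=> w sA a.
  by move=> /mapP[b bs ->] /=; rewrite pK; have /= := sA b bs; rewrite ?pK.
by move=> as_; have /= := sA (p a) (map_f p as_); rewrite pK.
Qed.

Variable mu : probability path_space R.
Hypothesis lmu : gaussian_law mu.

Let mu_fin : (mu setT < +oo)%E. Proof. by rewrite probability_setT ltry. Qed.

Lemma gaussian_law_upd a A : measurable A ->
  mu A = pushforward (mu \x gauss)%E
    (fun p : path_space * R => upd p.1 a p.2) A.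
Proof.
move=> mA; apply: (@path_measure_unique mu (pushforward (mu \x gauss)%E
  (fun p : path_space * R => upd p.1 a p.2)) mu_fin) => //.
  exact: measurable_upd.
move=> mupd _ [s [B [us mB ->]]].
rewrite [RHS]/= /pushforward preimage_upd_box// product_measure1E; last 2 first.
- by apply: measurable_box => //; exact: rem_uniq.
- by case: ifP => _; [exact: mB|exact: measurableT].
rewrite [LHS](lmu us mB) [X in _ = (X * _)%E](lmu (rem_uniq a us) mB).
case: ifPn => as_; first by rewrite (big_rem a as_)/= muleC.
by rewrite [X in (_ * X)%E](probability_setT gauss) mule1 rem_id.
Qed.

Lemma gaussian_law_reindex (p : I -> I) A : involutive p -> measurable A ->
  mu A = pushforward mu (fun w : path_space => (w \o p : path_space)) A.
Proof.
move=> pK mA; have mp := measurable_reindex p.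
apply: (@path_measure_unique mu (pushforward mu
  (fun w : path_space => (w \o p : path_space))) mu_fin) => //.
move=> _ [s [B [us mB ->]]].
have ups : uniq (map p s) by rewrite map_inj_uniq//; exact: inv_inj.
rewrite [RHS]/= /pushforward preimage_reindex_box//.
rewrite [LHS](lmu us mB) [RHS](lmu ups (fun a => mB (p a))) big_map.
by apply: eq_bigr => b _ /=; rewrite pK.
Qed.

Lemma integral_reindex (p : I -> I) (X : path_space -> R) : involutive p ->
  mu.-integrable setT (EFin \o X) ->
  (\int[mu]_w (X w)%:E = \int[mu]_w (X (w \o p : path_space))%:E)%E.
Proof.
move=> pK iX; apply: (integral_image_law (measurable_reindex p)) => // A mA.
exact: gaussian_law_reindex.
Qed.

Lemma integral_upd a (X : path_space -> R) :
  mu.-integrable setT (EFin \o X) ->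
  (\int[mu]_w (X w)%:E = \int[mu]_w \int[gauss]_y (X (upd w a y))%:E)%E.
Proof.
move=> iX; have mupd := measurable_upd a.
have law := @gaussian_law_upd a.
rewrite (@integral_image_law _ _ _ _ _ (mu \x gauss)%E mu _ mupd law X iX).
rewrite -integral12_prod_meas1//.
exact: (@integrable_image_law _ _ _ _ _ (mu \x gauss)%E mu _ mupd law X iX).
Qed.

Lemma integrable_path_coord a (f : R -> R) :
  gauss.-integrable setT (EFin \o f) ->
  mu.-integrable setT (fun w => (f (w a))%:E).
Proof.
apply: (@integrable_image_law _ _ _ _ _ mu gauss (fun w => w a)
  (measurable_path_coord a)) => A mA.
have := lmu (erefl : uniq [:: a]) (fun=> mA); rewrite big_seq1 => lawE.
rewrite [LHS](esym lawE) /pushforward; congr (mu _); apply/seteqP.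
split=> [w|w Aw b]; first by apply; rewrite inE.
by rewrite inE => /eqP ->.
Qed.

Lemma gaussian_integration_by_parts a (X X' : path_space -> R) :
  mu.-integrable setT (fun w => (X w * w a)%:E) ->
  mu.-integrable setT (EFin \o X') ->
  (forall w (y : R),
     is_derive y 1 (fun y => X (upd w a y)) (X' (upd w a y))) ->
  (forall w, continuous (fun y => X' (upd w a y))) ->
  (forall w, exists C p, forall y,
     `|X (upd w a y)| <= C * (1 + y ^+ 2) ^+ p /\
     `|X' (upd w a y)| <= C * (1 + y ^+ 2) ^+ p) ->
  (\int[mu]_w (X w * w a)%:E = \int[mu]_w (X' w)%:E)%E.
Proof.
move=> iX iX' dX cX' X_le; rewrite (integral_upd a iX) (integral_upd a iX').
apply: eq_integral => w _; have [C [p Xw_le]] := X_le w.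
under eq_integral do rewrite upd_same.
by apply: (@stein _ _ _ C p) => // y; have [] := Xw_le y.
Qed.

End path_space.

Arguments path_space : clear implicits.

(** * Measurability of continuous functions of random vectors *)

Section measurable_rV.
Context {R : realType} {d : nat} {dT : measure_display}.
Context {T : measurableType dT}.
Implicit Types X Y : T -> 'rV[R]_d.

Definition measurable_rV X :=
  forall k, measurable_fun setT (fun t => X t ord0 k).

Lemma measurable_rVD X Y :
  measurable_rV X -> measurable_rV Y -> measurable_rV (fun t => X t + Y t).
Proof.
by move=> mX mY k; under eq_fun do rewrite mxE; exact: measurable_funD.
Qed.

Lemma measurable_rVZ (c : T -> R) X :
  measurable_fun setT c -> measurable_rV X ->
  measurable_rV (fun t => c t *: X t).
Proof.
by move=> mc mX k; under eq_fun do rewrite mxE; exact: measurable_funM.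
Qed.

Definition rational_cube (p : 'rV[rat]_d * nat) : set 'rV[R]_d :=
  [set y | forall k, `|y ord0 k - ratr (p.1 ord0 k)| < p.2.+1%:R^-1].

Lemma measurable_preimage_rational_cube X p :
  measurable_rV X -> measurable (X @^-1` rational_cube p).
Proof.
move=> mX; rewrite (_ : _ @^-1` _ = \bigcap_(k in [set: 'I_d])
    ((fun t => X t ord0 k - ratr (p.1 ord0 k)) @^-1`
      `](- p.2.+1%:R^-1), p.2.+1%:R^-1[%classic)).
  apply: fin_bigcap_measurable => // k _; rewrite -[X in measurable X]setTI.
  by apply: measurable_funB => //; exact: measurable_itv.
apply/seteqP; split=> [t Xt k _|t Xt k].
  by rewrite /= in_itv/= -ltr_norml; exact: Xt.
by have := Xt k I; rewrite /= in_itv/= -ltr_norml.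
Qed.

Lemma open_rational_cube (V : set 'rV[R]_d) x : open V -> V x ->
  exists p, rational_cube p x /\ rational_cube p `<=` V.
Proof.
move=> oV Vx.
have /nbhs_ballP[e /= e0 eV] : nbhs x V by exact: open_nbhs_nbhs.
have [r re] : exists r : nat, r.+1%:R^-1 < e / 2.
  have [r] := ltr_add_invr (divr_gt0 e0 (ltr0n R 2) : 0 < e / 2).
  by rewrite add0r; exists r.
have rat_near k : exists q : rat, `|x ord0 k - ratr q| < r.+1%:R^-1.
  have [|q] := @rat_in_itvoo R (x ord0 k - r.+1%:R^-1) (x ord0 k + r.+1%:R^-1).
    by rewrite ltrBlDr -addrA ltrDl addr_gt0.
  by rewrite in_itv/= => qx; exists q; rewrite distrC ltr_distl.
have [q qx] := choice rat_near.
exists (\row_k q k, r); split=> [k|y qy]; first by rewrite /= mxE; exact: qx.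
apply: eV; split => // i k; rewrite (ord1 i) /ball/=.
rewrite (le_lt_trans (ler_distD (ratr (q k)) _ _))// [ltRHS]splitr.
apply: ltrD; apply: lt_trans re; first exact: qx.
by have := qy k; rewrite /= mxE distrC.
Qed.

Lemma measurable_continuous_rV (g : 'rV[R]_d -> R) X :
  continuous g -> measurable_rV X -> measurable_fun setT (fun t => g (X t)).
Proof.
move=> cg mX; apply: (measurability _ (RGenOpens.measurableE R)).
move=> _ [_ [a [b ->]] <-]; rewrite setTI.
set V := g @^-1` `]a, b[%classic.
have oV : open V by apply: open_comp => // x _; exact: cg.
pose cover (N : nat) : set T := if unpickle N is Some p then
  if `[< rational_cube p `<=` V >] then X @^-1` rational_cube p else set0
  else set0.
rewrite (_ : _ @^-1` _ = \bigcup_N cover N).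
  apply: bigcup_measurable => N _; rewrite /cover; case: unpickle => // p.
  by case: ifP => // _; exact: measurable_preimage_rational_cube.
apply/seteqP; split=> [t Vt|t [N _]]; last first.
  by rewrite /cover; case: unpickle => // p; case: ifPn => // /asboolP pV /pV.
have [p [pX pV]] := open_rational_cube oV Vt.
by exists (pickle p) => //; rewrite /cover pickleK asboolT.
Qed.

End measurable_rV.

Lemma exprD_le (R : realDomainType) (x y : R) p : 0 <= x -> 0 <= y ->
  (x + y) ^+ p <= 2 ^+ p * (x ^+ p + y ^+ p).
Proof.
wlog xy : x y / x <= y => [th x0 y0|x0 y0].
  have [xy|/ltW yx] := leP x y; first exact: th.
  by rewrite addrC [_ ^+ p + _]addrC; exact: th.
rewrite (@le_trans _ _ ((2 * y) ^+ p))//.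
  by rewrite lerXn2r ?nnegrE ?addr_ge0 ?mulr_ge0//; lra.
by rewrite exprMn ler_wpM2l ?exprn_ge0// lerDr exprn_ge0.
Qed.

(** * Random variables of polynomial growth *)

Section poly_growth.
Context {R : realType} {I : eqType}.
Local Notation W := (path_space R I).
Implicit Types (X Y : W -> R) (S : seq I) (w : W) (p : nat).

Definition weight S w : R := 1 + \sum_(a <- S) w a ^+ 2.

(* A class, so that instance resolution discharges the integrability side
   conditions of the rules for expectations. *)
Class poly_growth X : Prop := PolyGrowth {
  measurable_poly_growth : measurable_fun setT X;
  poly_growth_bound : exists S p C, forall w, `|X w| <= C * weight S w ^+ p }.

Lemma weight_ge1 S w : 1 <= weight S w.
Proof. by rewrite lerDl sumr_ge0// => a _; rewrite sqr_ge0. Qed.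

Lemma weight_ge0 S w p : 0 <= weight S w ^+ p.
Proof. by rewrite exprn_ge0// (le_trans ler01)// weight_ge1. Qed.

Lemma measurable_weight S : measurable_fun setT (weight S).
Proof.
apply: measurable_funD => //; apply: measurable_sum => a.
by apply: measurable_funX; exact: measurable_path_coord.
Qed.

Lemma weight_catC S T w : weight (S ++ T) w = weight (T ++ S) w.
Proof. by rewrite /weight !big_cat /= [X in 1 + X]addrC. Qed.

Lemma weight_exp_cat S T p q w :
  weight S w ^+ p <= weight (S ++ T) w ^+ (p + q).
Proof.
have [S1 ST1] := (weight_ge1 S w, weight_ge1 (S ++ T) w).
rewrite (@le_trans _ _ (weight (S ++ T) w ^+ p)) ?ler_weXn2l ?leq_addr//.
rewrite lerXn2r ?nnegrE ?(le_trans ler01)// /weight big_cat lerD2l lerDl.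
by rewrite sumr_ge0// => a _; rewrite sqr_ge0.
Qed.

Lemma weight_bound_cat S T p q (C D : R) w :
  C * weight S w ^+ p <= (`|C| + `|D|) * weight (S ++ T) w ^+ (p + q).
Proof.
rewrite (le_trans (ler_wpM2r (weight_ge0 _ _ _) (ler_norm C)))//.
by rewrite ler_pM ?weight_ge0 ?weight_exp_cat// lerDl.
Qed.

Lemma poly_growth_common X Y : poly_growth X -> poly_growth Y ->
  exists S p C, 0 <= C /\
  forall w, `|X w| <= C * weight S w ^+ p /\ `|Y w| <= C * weight S w ^+ p.
Proof.
move=> [_ [S [p [C XC]]]] [_ [T [q [D YD]]]].
exists (S ++ T), (p + q)%N, (`|C| + `|D|); split => [|w]; first exact: addr_ge0.
split; first exact: le_trans (XC w) (weight_bound_cat _ _ _ _ _ _ _).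
by rewrite weight_catC addnC addrC (le_trans (YD w)) ?weight_bound_cat.
Qed.

Lemma poly_growth_dominated X Y : measurable_fun setT X -> poly_growth Y ->
  (forall w, `|X w| <= Y w) -> poly_growth X.
Proof.
move=> mX [_ [S [p [C YC]]]] XY; split=> //; exists S, p, C => w.
by rewrite (le_trans (XY w))// (le_trans (ler_norm _)).
Qed.

Lemma poly_growth_bounded X C :
  measurable_fun setT X -> (forall w, `|X w| <= C) -> poly_growth X.
Proof.
by move=> mX XC; split=> //; exists [::], 0%N, C => w; rewrite expr0 mulr1.
Qed.

#[global] Instance poly_growth_cst (c : R) : poly_growth (fun=> c).
Proof. exact: (@poly_growth_bounded _ `|c|). Qed.

#[global] Instance poly_growth_path_coord a : poly_growth (fun w => w a).
Proof.
split; first exact: measurable_path_coord.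
exists [:: a], 1%N, 1 => w; rewrite mul1r /weight big_seq1.
have := sqr_ge0 (`|w a| - 1); rewrite -[w a ^+ 2]real_normK ?num_real//.
by have := normr_ge0 (w a); nra.
Qed.

#[global] Instance poly_growthD X Y :
  poly_growth X -> poly_growth Y -> poly_growth (fun w => X w + Y w).
Proof.
move=> gX gY; have [S [p [C [C0 XYC]]]] := poly_growth_common gX gY.
split; first by apply: measurable_funD; exact: measurable_poly_growth.
exists S, p, (C + C) => w; have [XC YC] := XYC w.
by rewrite mulrDl (le_trans (ler_normD _ _)) ?lerD.
Qed.

#[global] Instance poly_growthM X Y :
  poly_growth X -> poly_growth Y -> poly_growth (fun w => X w * Y w).
Proof.
move=> gX gY; have [S [p [C [C0 XYC]]]] := poly_growth_common gX gY.
split; first by apply: measurable_funM; exact: measurable_poly_growth.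
exists S, (p + p)%N, (C * C) => w; have [XC YC] := XYC w.
by rewrite normrM exprD mulrACA ler_pM.
Qed.

#[global] Instance poly_growthN X :
  poly_growth X -> poly_growth (fun w => - X w).
Proof. by move=> gX; under eq_fun do rewrite -mulN1r; exact: _. Qed.

#[global] Instance poly_growth_normr X :
  poly_growth X -> poly_growth (fun w => `|X w|).
Proof.
move=> [mX [S [p [C XC]]]]; split; first exact: measurableT_comp.
by exists S, p, C => w; rewrite normr_id.
Qed.

#[global] Instance poly_growth_exp X p :
  poly_growth X -> poly_growth (fun w => X w ^+ p).
Proof.
move=> gX; elim: p => [|p IH]; first exact: poly_growth_cst.
by under eq_fun do rewrite exprS; exact: _.
Qed.

#[global] Instance poly_growth_sum (J : Type) (r : seq J) (P : pred J)
    (F : J -> W -> R) : (forall j, poly_growth (F j)) ->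
  poly_growth (fun w => \sum_(j <- r | P j) F j w).
Proof.
move=> gF; elim: r => [|j r IH].
  by under eq_fun do rewrite big_nil; exact: poly_growth_cst.
under eq_fun do rewrite big_cons.
by case: (P j); exact: _.
Qed.

End poly_growth.

Section expectation.
Context {R : realType} {I : eqType}.
Local Notation W := (path_space R I).
Local Notation gauss := (@normal_prob R 0 1).
Variable mu : probability W R.
Hypothesis lmu : gaussian_law mu.
Implicit Types (X Y : W -> R) (S : seq I) (p : nat).

Lemma integrable_path_coord_exp a p :
  mu.-integrable setT (fun w => ((w a ^+ 2) ^+ p)%:E).
Proof.
apply: (integrable_path_coord lmu a (f := fun y => (y ^+ 2) ^+ p)).
apply: (@integrable_poly_normal _ 1 p) => [|y].
  by do 2 apply: measurable_funX.
have [y2 y3] : 0 <= y ^+ 2 /\ 0 <= 1 + y ^+ 2 by have := sqr_ge0 y; lra.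
rewrite mul1r ger0_norm; last exact: exprn_ge0.
by rewrite lerXn2r ?nnegrE// lerDr.
Qed.

Lemma integrable_weight_exp S p :
  mu.-integrable setT (fun w => (weight S w ^+ p)%:E).
Proof.
elim: S => [|a S IH].
  apply: (eq_integrable measurableT (cst 1%:E)) => [w _|].
    by rewrite /weight big_nil addr0 expr1n.
  exact: finite_measure_integrable_cst.
apply: (@le_integrable _ _ _ mu setT _ _ (fun w =>
    (2 ^+ p)%:E * (weight S w ^+ p)%:E +
    (2 ^+ p)%:E * ((w a ^+ 2) ^+ p)%:E)%E) => //.
- by apply/measurable_EFinP/measurable_funX; exact: measurable_weight.
- move=> w _; rewrite -!EFinM -EFinD lee_fin -mulrDr.
  have S0 : 0 <= weight S w by rewrite (le_trans ler01) ?weight_ge1.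
  rewrite (le_trans _ (ler_norm _))// (ger0_norm (weight_ge0 _ _ _)).
  rewrite (le_trans _ (exprD_le p S0 (sqr_ge0 (w a))))//.
  by rewrite /weight big_cons addrCA addrC.
- apply: integrableD => //; apply: integrableZl => //.
  exact: integrable_path_coord_exp.
Qed.

Lemma poly_growth_integrable X :
  poly_growth X -> mu.-integrable setT (EFin \o X).
Proof.
move=> [mX [S [p [C XC]]]]; apply: (@le_integrable _ _ _ mu setT _ _
  (fun w => C%:E * (weight S w ^+ p)%:E)%E) => //.
- exact/measurable_EFinP.
- by move=> w _; rewrite /= lee_fin (le_trans (XC w))// ler_norm.
- by apply: integrableZl => //; exact: integrable_weight_exp.
Qed.

Definition mean X : R := \int[mu]_w X w.

Lemma meanE X : poly_growth X -> (\int[mu]_w (X w)%:E = (mean X)%:E)%E.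
Proof.
move=> gX; rewrite /mean /Rintegral fineK//.
by apply: integrable_fin_num => //; exact: poly_growth_integrable.
Qed.

Lemma mean_cst c : mean (fun=> c) = c.
Proof.
by rewrite /mean Rintegral_cst// [X in fine X](probability_setT mu) mulr1.
Qed.

Lemma meanD X Y : poly_growth X -> poly_growth Y ->
  mean (fun w => X w + Y w) = mean X + mean Y.
Proof.
by move=> gX gY; apply: RintegralD => //; exact: poly_growth_integrable.
Qed.

Lemma meanZ c X : poly_growth X -> mean (fun w => c * X w) = c * mean X.
Proof.
by move=> gX; apply: RintegralZl => //; exact: poly_growth_integrable.
Qed.

Lemma meanB X Y : poly_growth X -> poly_growth Y ->
  mean (fun w => X w - Y w) = mean X - mean Y.
Proof.
by move=> gX gY; apply: RintegralB => //; exact: poly_growth_integrable.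
Qed.

Lemma mean_sum (J : Type) (r : seq J) (F : J -> W -> R) :
  (forall j, poly_growth (F j)) ->
  mean (fun w => \sum_(j <- r) F j w) = \sum_(j <- r) mean (F j).
Proof.
move=> gF; elim: r => [|j r IH].
  rewrite big_nil -[RHS](mean_cst 0); congr mean; apply/funext => w.
  by rewrite big_nil.
rewrite big_cons -IH -meanD; congr mean.
by apply/funext => w; rewrite big_cons.
Qed.

Lemma ler_mean X Y : poly_growth X -> poly_growth Y ->
  (forall w, X w <= Y w) -> mean X <= mean Y.
Proof.
by move=> gX gY XY; apply: le_Rintegral => //; exact: poly_growth_integrable.
Qed.

Lemma mean_reindex (p : I -> I) X : involutive p -> poly_growth X ->
  mean (fun w => X (w \o p)) = mean X.
Proof.
move=> pK gX; rewrite /mean /Rintegral; congr fine; apply/esym.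
by apply: integral_reindex => //; exact: poly_growth_integrable.
Qed.

End expectation.

Section partial_derivative.
Context {R : realType} {I : eqType}.
Local Notation W := (path_space R I).
Implicit Types (X Y : W -> R) (a : I) (w : W).

Definition has_partial a X X' : Prop :=
  (forall w (y : R), is_derive y 1 (fun y => X (upd w a y)) (X' (upd w a y))) /\
  (forall w, continuous (fun y => X' (upd w a y))).

Lemma has_partial_continuous a X X' w :
  has_partial a X X' -> continuous (fun y => X (upd w a y)).
Proof.
move=> [dX _] y; have dXy := dX w y.
by apply/differentiable_continuous/derivable1_diffP; exact: ex_derive.
Qed.

Lemma has_partial_invariant a X :
  (forall w y, X (upd w a y) = X w) -> has_partial a X (fun=> 0).
Proof.
move=> Xa; split=> w y; last exact: cvg_cst.
by under eq_fun do rewrite Xa; exact: is_derive_cst.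
Qed.

Lemma has_partial_path_coord a : has_partial a (fun w => w a) (fun=> 1).
Proof.
split=> w y; last exact: cvg_cst.
by under eq_fun do rewrite upd_same; exact: is_derive_id.
Qed.

Lemma has_partialD a X X' Y Y' : has_partial a X X' -> has_partial a Y Y' ->
  has_partial a (fun w => X w + Y w) (fun w => X' w + Y' w).
Proof.
move=> [dX cX'] [dY cY']; split=> w y.
  by have dXy := dX w y; have dYy := dY w y; apply: is_derive_eq.
by apply: cvgD; [exact: cX'|exact: cY'].
Qed.

Lemma has_partialM a X X' Y Y' : has_partial a X X' -> has_partial a Y Y' ->
  has_partial a (fun w => X w * Y w) (fun w => X' w * Y w + X w * Y' w).
Proof.
move=> hX hY; have [[dX cX'] [dY cY']] := (hX, hY); split=> w y.
  have dXy := dX w y; have dYy := dY w y.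
  by apply: is_derive_eq; rewrite addrC [_ *: X' _]mulrC.
have cX := has_partial_continuous (w := w) hX.
have cY := has_partial_continuous (w := w) hY.
by apply: cvgD; apply: cvgM; [exact: cX'|exact: cY|exact: cX|exact: cY'].
Qed.

Lemma has_partial_sum a (J : Type) (r : seq J) (F F' : J -> W -> R) :
  (forall j, has_partial a (F j) (F' j)) ->
  has_partial a (fun w => \sum_(j <- r) F j w) (fun w => \sum_(j <- r) F' j w).
Proof.
move=> hF; elim: r => [|j r IH].
  under eq_fun do rewrite big_nil.
  under [X in has_partial _ _ X]eq_fun do rewrite big_nil.
  exact: has_partial_invariant.
under eq_fun do rewrite big_cons.
under [X in has_partial _ _ X]eq_fun do rewrite big_cons.
exact: has_partialD.
Qed.

Lemma has_partialX a X X' p : has_partial a X X' ->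
  has_partial a (fun w => X w ^+ p) (fun w => p%:R * X w ^+ p.-1 * X' w).
Proof.
move=> hX; case: p => [|p].
  by under [X in has_partial _ _ X]eq_fun do rewrite !mul0r;
    exact: has_partial_invariant.
elim: p => [|p IH].
  by under [X in has_partial _ _ X]eq_fun do rewrite !mul1r.
have XE : (fun w => X w ^+ p.+2) = (fun w => X w * X w ^+ p.+1).
  by apply/funext => w; rewrite exprS.
have X'E : (fun w => p.+2%:R * X w ^+ p.+1 * X' w) =
    (fun w => X' w * X w ^+ p.+1 + X w * (p.+1%:R * X w ^+ p * X' w)).
  by apply/funext => w; rewrite -(natr1 p.+1) exprS; ring.
by rewrite XE X'E; exact: has_partialM.
Qed.

Lemma weight_upd S w a (y : R) :
  weight S (upd w a y) <= (weight S w + (size S)%:R) * (1 + y ^+ 2).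
Proof.
have y2 := sqr_ge0 y; elim: S => [|b S IH].
  by rewrite /weight !big_nil !addr0 mul1r lerDl.
have weight_cons (v : W) : weight (b :: S) v = weight S v + v b ^+ 2.
  by rewrite /weight big_cons addrCA addrC.
have upd_le : upd w a y b ^+ 2 <= (w b ^+ 2 + 1) * (1 + y ^+ 2).
  have w2 := sqr_ge0 (w b); have := mulr_ge0 w2 y2.
  by rewrite /upd/=; case: (b == a) => ?; nra.
rewrite !weight_cons /= -natr1.
by have := lerD IH upd_le; rewrite -mulrDl addrACA.
Qed.

Variable mu : probability W R.
Hypothesis lmu : gaussian_law mu.

Lemma mean_integration_by_parts a X X' :
  has_partial a X X' -> poly_growth X -> poly_growth X' ->
  mean mu (fun w => X w * w a) = mean mu X'.
Proof.
move=> [dX cX'] gX gX'; congr fine.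
apply: (gaussian_integration_by_parts lmu) => //.
- exact: poly_growth_integrable.
- exact: poly_growth_integrable.
move=> w; have [S [p [C [C0 XC]]]] := poly_growth_common gX gX'.
pose K := weight S w + (size S)%:R.
exists (C * K ^+ p), p => y; have [XC1 XC2] := XC (upd w a y).
have K_le : C * weight S (upd w a y) ^+ p <= C * K ^+ p * (1 + y ^+ 2) ^+ p.
  have upd_le := weight_upd S w a y.
  have upd_ge0 := le_trans ler01 (weight_ge1 S (upd w a y)).
  by rewrite -mulrA -exprMn ler_wpM2l// lerXn2r ?nnegrE// (le_trans upd_ge0).
by split; [exact: le_trans XC1 K_le|exact: le_trans XC2 K_le].
Qed.

End partial_derivative.

(** * Symmetric difference quotients *)

Section difference_quotient.
Context {R : realType} {d : nat}.
Variables (g : 'rV[R]_d -> R) (G L u : R).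
Hypotheses (G_ge0 : 0 <= G) (u_gt0 : 0 < u).
Hypotheses (lg : lipschitz2 G g) (sg : smooth2 L g).
Implicit Types x y z : 'rV[R]_d.

Definition dquot x z : R := (g (x + u *: z) - g (x - u *: z)) / (2 * u).

(* The gradient of [dquot x] with respect to the perturbation. *)
Definition sym_grad x z : 'rV[R]_d :=
  2^-1 *: (grad g (x + u *: z) + grad g (x - u *: z)).

Lemma normr_dquot_sub_dot x z :
  `|dquot x z - dot (grad g x) z| <= L * u / 2 * norm2 z ^+ 2.
Proof.
have taylor_p := smooth2_taylor x (u *: z) sg.
have taylor_m := smooth2_taylor x (- (u *: z)) sg.
rewrite norm2N dotNr in taylor_m.
rewrite !norm2Z !dotZr (gtr0_norm u_gt0) in taylor_p taylor_m.
have -> : dquot x z - dot (grad g x) z = (2 * u)^-1 *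
   ((g (x + u *: z) - g x - u * dot (grad g x) z) -
    (g (x - u *: z) - g x - - (u * dot (grad g x) z))).
  by rewrite /dquot; field; rewrite gt_eqF.
have u2 : 0 < 2 * u by rewrite mulr_gt0.
rewrite normrM normfV (gtr0_norm u2) ler_pdivrMl//.
rewrite (le_trans (ler_normB _ _))// (le_trans (lerD taylor_p taylor_m))//.
by rewrite exprMn; lra.
Qed.

Lemma normr_sym_grad_le x z k : `|sym_grad x z ord0 k| <= G.
Proof.
have coord_le y : `|grad g y ord0 k| <= G.
  exact: le_trans (ler_coord_norm2 _ _) (norm2_grad_le y G_ge0 sg.1 lg).
rewrite mxE normrM ger0_norm ?invr_ge0// ler_pdivrMl// mxE.
by rewrite (le_trans (ler_normD _ _))// mulr_natl mulr2n lerD.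
Qed.

Lemma norm2_half_sum_le x y c :
  norm2 x <= c -> norm2 y <= c -> norm2 (2^-1 *: (x + y)) <= c.
Proof.
move=> xc yc; rewrite norm2Z ger0_norm ?invr_ge0// ler_pdivrMl//.
by rewrite (le_trans (norm2D _ _))// mulr_natl mulr2n lerD.
Qed.

Lemma sym_grad_lipschitz x y z :
  norm2 (sym_grad x z - sym_grad y z) <= L * norm2 (x - y).
Proof.
rewrite /sym_grad -scalerBr opprD addrACA.
by apply: norm2_half_sum_le; rewrite (le_trans (sg.2 _ _))//
  opprD addrACA subrr addr0.
Qed.

Lemma norm2_sym_grad_sub_grad x z :
  norm2 (sym_grad x z - grad g x) <= L * u * norm2 z.
Proof.
have -> : sym_grad x z - grad g x = 2^-1 *:
    ((grad g (x + u *: z) - grad g x) + (grad g (x - u *: z) - grad g x)).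
  rewrite addrACA -opprD scalerBr -[grad g x + _]mulr2n.
  by rewrite -[grad g x *+ 2]scaler_nat scalerA mulVf ?scale1r// pnatr_eq0.
have zE : L * norm2 (u *: z) = L * u * norm2 z.
  by rewrite norm2Z gtr0_norm// mulrA.
by apply: norm2_half_sum_le; rewrite (le_trans (sg.2 _ _))//
  addrC addKr ?norm2N zE.
Qed.

Lemma dot_grad_sym_grad_ge x z :
  2^-1 * norm2 (grad g x) ^+ 2 - 2^-1 * (L * u * norm2 z) ^+ 2 <=
  dot (grad g x) (sym_grad x z).
Proof.
rewrite -[sym_grad x z](subrK (grad g x)) dotDr -norm2_sqrE.
have := dot_young (grad g x) (sym_grad x z - grad g x) ltr01.
have := norm2_sqr_le (norm2_sym_grad_sub_grad x z).
by rewrite mulr1; lra.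
Qed.

Lemma is_derive_dquot x z k (s : R) :
  is_derive s 1 (fun r : R => dquot x (z + r *: delta_mx ord0 k))
    (sym_grad x (z + s *: delta_mx ord0 k) ord0 k).
Proof.
set v := delta_mx ord0 k.
have lineE c (r : R) : x + c *: z + r *: (c *: v) = x + c *: (z + r *: v).
  by rewrite scalerDr addrA !scalerA mulrC.
have d1 := is_derive_line (x + u *: z) (u *: v) s sg.1.
have d2 := is_derive_line (x + (- u) *: z) ((- u) *: v) s sg.1.
rewrite !lineE !dotZr !dot_delta in d1 d2.
have -> : (fun r : R => dquot x (z + r *: v)) = (fun r : R => (2 * u)^-1 *
    (g (x + u *: z + r *: (u *: v)) - g (x + (- u) *: z + r *: ((- u) *: v)))).
  by apply/funext => r; rewrite !lineE scaleNr /dquot mulrC.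
apply: is_derive_eq; rewrite [sym_grad _ _ _ _]mxE [X in _ = _ * X]mxE.
rewrite -(scaleNr u (z + _)) /GRing.scale/=.
by field; rewrite gt_eqF.
Qed.

Lemma continuous_sym_grad_line x z v k :
  continuous (fun r : R => sym_grad x (z + r *: v) ord0 k).
Proof.
have cline c : continuous (fun r : R => x + c *: (z + r *: v)).
  move=> r; apply: cvgD; first exact: cvg_cst.
  apply: cvgZ; first exact: cvg_cst.
  apply: cvgD; first exact: cvg_cst.
  by apply: cvgZ; [exact: cvg_id|exact: cvg_cst].
have cg : continuous (fun y => grad g y ord0 k) by exact: continuous_grad sg.
have cgrad c : continuous (fun r : R => grad g (x + c *: (z + r *: v)) ord0 k).
  move=> r; exact: (@continuous_comp _ _ _ (fun r : R => x + c *: (z + r *: v))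
    (fun y => grad g y ord0 k) r (cline c r) (cg _)).
rewrite (_ : (fun r => _) = fun r => 2^-1 *
    (grad g (x + u *: (z + r *: v)) ord0 k +
     grad g (x + (- u) *: (z + r *: v)) ord0 k)).
  move=> r; apply: cvgM; first exact: cvg_cst.
  by apply: cvgD; exact: cgrad.
by apply/funext => r; rewrite [LHS]mxE [X in _ * X]mxE scaleNr.
Qed.

End difference_quotient.

Lemma sym_grad_objective (R : realType) (n d : nat)
    (f : 'I_n -> 'rV[R]_d -> R) (L u : R) x z :
  (forall i, smooth2 L (f i)) ->
  sym_grad (objective f) u x z = n%:R^-1 *: \sum_(j < n) sym_grad (f j) u x z.
Proof.
move=> sf; rewrite /sym_grad !(grad_objective sf) -scalerDr -big_split/=.
by rewrite -scaler_sumr !scalerA mulrC.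
Qed.

(** * Vectors assembled block by block *)

Section splice.
Context {R : realType} {n d : nat} (blk : 'I_d -> 'I_n).
Implicit Types V : 'I_n -> 'rV[R]_d.

Definition splice V : 'rV[R]_d := \row_k V (blk k) ord0 k.

Lemma norm2_splice_sqr V :
  norm2 (splice V) ^+ 2 <= \sum_(i < n) norm2 (V i) ^+ 2.
Proof.
rewrite norm2_sqr (partition_big blk xpredT)//=; apply: ler_sum => i _.
rewrite norm2_sqr [leRHS](bigID (fun k => blk k == i))/=.
rewrite (eq_bigr (fun k => V i ord0 k ^+ 2)) => [|k /eqP ki].
  by rewrite lerDl sumr_ge0// => k _; rewrite sqr_ge0.
by rewrite mxE ki.
Qed.

Lemma norm2_sub_splice_sqr x V :
  norm2 (x - splice V) ^+ 2 <= \sum_(i < n) norm2 (x - V i) ^+ 2.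
Proof.
have -> : x - splice V = splice (fun i => x - V i).
  by apply/rowP => k; rewrite !mxE.
exact: norm2_splice_sqr.
Qed.

End splice.

(** * Random vectors of polynomial growth *)

Existing Class lipschitz2.
Existing Class smooth2.

Section poly_growth_rV.
Context {R : realType} {I : eqType} {d : nat}.
Local Notation W := (path_space R I).
Implicit Types (U V : W -> 'rV[R]_d) (g : 'rV[R]_d -> R).

Class poly_growth_rV V : Prop :=
  poly_growth_coord : forall k, poly_growth (fun w => V w ord0 k).

#[global] Instance poly_growth_rV_coord V k :
  poly_growth_rV V -> poly_growth (fun w => V w ord0 k).
Proof. by []. Qed.

Lemma poly_growth_rV_measurable V : poly_growth_rV V -> measurable_rV V.
Proof. by move=> gV k; exact: measurable_poly_growth. Qed.

#[global] Instance poly_growth_rV_cst v : poly_growth_rV (fun=> v).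
Proof. by move=> k; exact: _. Qed.

#[global] Instance poly_growth_rVD U V :
  poly_growth_rV U -> poly_growth_rV V -> poly_growth_rV (fun w => U w + V w).
Proof. by move=> gU gV k; under eq_fun do rewrite mxE; exact: _. Qed.

#[global] Instance poly_growth_rVN V :
  poly_growth_rV V -> poly_growth_rV (fun w => - V w).
Proof. by move=> gV k; under eq_fun do rewrite mxE; exact: _. Qed.

#[global] Instance poly_growth_rVZ (c : W -> R) V :
  poly_growth c -> poly_growth_rV V -> poly_growth_rV (fun w => c w *: V w).
Proof. by move=> gc gV k; under eq_fun do rewrite mxE; exact: _. Qed.

#[global] Instance poly_growth_rV_sum (J : Type) (r : seq J)
    (V : J -> W -> 'rV[R]_d) : (forall j, poly_growth_rV (V j)) ->
  poly_growth_rV (fun w => \sum_(j <- r) V j w).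
Proof. by move=> gV k; under eq_fun do rewrite summxE; exact: _. Qed.

#[global] Instance poly_growth_splice (n : nat) (blk : 'I_d -> 'I_n)
    (V : 'I_n -> W -> 'rV[R]_d) : (forall i, poly_growth_rV (V i)) ->
  poly_growth_rV (fun w => splice blk (fun i => V i w)).
Proof. by move=> gV k; under eq_fun do rewrite mxE; exact: _. Qed.

Lemma lipschitz2_norm2 : lipschitz2 1 (@norm2 R d).
Proof.
move=> x y; rewrite mul1r ler_norml lerNl opprB !lerBlDr; apply/andP; split.
  by rewrite -(norm2N (x - y)) opprB (le_trans _ (norm2D _ _))// subrK.
by rewrite (le_trans _ (norm2D _ _))// subrK.
Qed.

#[global] Instance poly_growth_norm2 V :
  poly_growth_rV V -> poly_growth (fun w => norm2 (V w)).
Proof.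
move=> gV; apply: (@poly_growth_dominated _ _ _
    (fun w => \sum_(k < d) `|V w ord0 k|)) => [|w].
  apply: measurable_continuous_rV (poly_growth_rV_measurable gV).
  exact: lipschitz2_continuous lipschitz2_norm2.
by rewrite ger0_norm ?norm2_ge0// norm2_le_sum.
Qed.

#[global] Instance poly_growth_lipschitz2 G g V :
  lipschitz2 G g -> poly_growth_rV V -> poly_growth (fun w => g (V w)).
Proof.
move=> lg gV; apply: (@poly_growth_dominated _ _ _
    (fun w => `|g 0| + G * norm2 (V w))) => [|w].
  apply: measurable_continuous_rV (poly_growth_rV_measurable gV).
  exact: lipschitz2_continuous lg.
rewrite -{1}(subrK (g 0) (g (V w))) addrC (le_trans (ler_normD _ _))// lerD2l.
by rewrite (le_trans (lg _ _))// subr0.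
Qed.

#[global] Instance poly_growth_grad L g V :
  smooth2 L g -> poly_growth_rV V -> poly_growth_rV (fun w => grad g (V w)).
Proof.
move=> sg gV k; exact: (poly_growth_lipschitz2 (g := fun x => grad g x ord0 k)
  (lipschitz2_grad k sg) gV).
Qed.

End poly_growth_rV.

(** * Moments of the perturbations *)

Section perturbation.
Context {R : realType} {d : nat}.
Local Notation W := (path_space R (nat * 'I_d)%type).
Implicit Types (w : W) (s t p : nat) (k l : 'I_d).

Definition pert w t : 'rV[R]_d := \row_k w (t, k).

#[global] Instance poly_growth_pert t : poly_growth_rV (fun w => pert w t).
Proof. by move=> k; under eq_fun do rewrite mxE; exact: _. Qed.

Definition adapted (A : Type) t (X : W -> A) := forall w w',
  (forall s k, (s < t)%N -> w (s, k) = w' (s, k)) -> X w = X w'.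

Lemma adapted_upd (A : Type) s t (X : W -> A) w k y :
  adapted s X -> (s <= t)%N -> X (upd w (t, k) y) = X w.
Proof.
move=> adX st; apply: adX => r l rs; apply: upd_other.
by rewrite xpair_eqE (ltn_eqF (leq_trans rs st)).
Qed.

Lemma has_partial_adapted s (X : W -> R) k :
  adapted s X -> has_partial (s, k) X (fun=> 0).
Proof.
move=> adX; apply: has_partial_invariant => w y; exact: adapted_upd adX _.
Qed.

Lemma pert_upd w s k y : pert (upd w (s, k) y) s =
  (pert w s - w (s, k) *: delta_mx ord0 k) + y *: delta_mx ord0 k.
Proof.
apply/rowP => l; rewrite !mxE /upd/= xpair_eqE eqxx/=.
by case: eqP => [->|_]; rewrite ?mulr1 ?mulr0 ?subrr ?subr0 ?addr0 ?add0r.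
Qed.

Lemma has_partial_pert s k l :
  has_partial (s, k) (fun w => pert w s ord0 l) (fun=> (l == k)%:R).
Proof.
under eq_fun do rewrite mxE; case: eqP => [->|/eqP lk].
  exact: has_partial_path_coord.
apply: has_partial_invariant => w y.
by rewrite upd_other// xpair_eqE negb_and lk orbT.
Qed.

Lemma has_partial_dot_pert s k (V : W -> 'rV[R]_d) : adapted s V ->
  has_partial (s, k) (fun w => dot (V w) (pert w s)) (fun w => V w ord0 k).
Proof.
move=> adV; have -> : (fun w => V w ord0 k) =
    (fun w => \sum_l (0 * pert w s ord0 l + V w ord0 l * (l == k)%:R)).
  apply/funext => w; rewrite (bigD1 k)//= big1 => [|l /negbTE ->].
    by rewrite eqxx mul0r mulr1 add0r addr0.
  by rewrite mul0r mulr0 addr0.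
apply: has_partial_sum => l; apply: has_partialM; last exact: has_partial_pert.
by apply: has_partial_adapted => w w' ww'; rewrite (adV w w').
Qed.

Lemma has_partial_norm2_pert s k :
  has_partial (s, k) (fun w => norm2 (pert w s) ^+ 2) (fun w => 2 * w (s, k)).
Proof.
have -> : (fun w => norm2 (pert w s) ^+ 2) =
    (fun w => \sum_l pert w s ord0 l * pert w s ord0 l).
  by apply/funext => w; exact: norm2_sqrE.
have -> : (fun w => 2 * w (s, k)) = (fun w : W => \sum_l
    ((l == k)%:R * pert w s ord0 l + pert w s ord0 l * (l == k)%:R)).
  apply/funext => w; rewrite (bigD1 k)//= big1 => [|l /negbTE ->].
    by rewrite eqxx mul1r mulr1 addr0 mxE mulr_natl mulr2n.
  by rewrite mul0r mulr0 addr0.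
by apply: has_partial_sum => l; apply: has_partialM; exact: has_partial_pert.
Qed.

Definition swap_time s t (a : nat * 'I_d) : nat * 'I_d :=
  (if a.1 == s then t else if a.1 == t then s else a.1, a.2).

Lemma swap_timeK s t : involutive (swap_time s t).
Proof.
move=> [r k]; rewrite /swap_time/=; congr pair.
have [->|rs] := eqVneq r s; first by have [->//|ts] := eqVneq t s; rewrite eqxx.
by have [->|rt] := eqVneq r t; rewrite ?eqxx// (negbTE rs) (negbTE rt).
Qed.

Lemma adapted_swap (A : Type) s t (X : W -> A) w :
  adapted s X -> (s <= t)%N -> X (w \o swap_time s t) = X w.
Proof.
move=> adX st; apply: adX => r l rs; rewrite /swap_time/=.
by rewrite (ltn_eqF rs) (ltn_eqF (leq_trans rs st)).
Qed.

Lemma pert_swap w s t : pert (w \o swap_time s t) s = pert w t.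
Proof. by apply/rowP => l; rewrite !mxE /swap_time/= eqxx. Qed.

Variable mu : probability W R.
Hypothesis lmu : gaussian_law mu.
Local Notation mean := (mean mu).

Lemma mean_norm2_pert_exp s p :
  mean (fun w => (norm2 (pert w s) ^+ 2) ^+ p.+1) =
  (d + 2 * p)%:R * mean (fun w => (norm2 (pert w s) ^+ 2) ^+ p).
Proof.
pose N w := norm2 (pert w s) ^+ 2.
have -> : (fun w => N w ^+ p.+1) =
    (fun w => \sum_k N w ^+ p * w (s, k) * w (s, k)).
  apply/funext => w; rewrite exprSr {2}/N norm2_sqr mulr_sumr.
  by apply: eq_bigr => k _; rewrite mxE expr2 mulrA.
rewrite (mean_sum lmu) -(meanZ lmu).
have ibp k : mean (fun w => N w ^+ p * w (s, k) * w (s, k)) =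
    mean (fun w => p%:R * N w ^+ p.-1 * (2 * w (s, k)) * w (s, k) +
                   N w ^+ p * 1).
  apply: mean_integration_by_parts => //.
  apply: has_partialM; last exact: has_partial_path_coord.
  by apply: has_partialX; exact: has_partial_norm2_pert.
under eq_bigr do rewrite ibp.
rewrite -(mean_sum lmu); congr mean; apply/funext => w.
rewrite big_split/= sumr_const card_ord mulr1 -[_ *+ d]mulr_natl -/(N w).
rewrite natrD natrM mulrDl [RHS]addrC.
congr (_ + _); have -> : 2 * p%:R * N w ^+ p = p%:R * N w ^+ p.-1 * 2 * N w.
  by case: p {ibp} => [|p]; rewrite ?mulr0 ?mul0r// exprSr/=; ring.
rewrite {3}/N norm2_sqr mulr_sumr; apply: eq_bigr => k _.
by rewrite mxE expr2 !mulrA.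
Qed.

Lemma mean_norm2_pert_sqr s : mean (fun w => norm2 (pert w s) ^+ 2) = d%:R.
Proof.
by have := mean_norm2_pert_exp s 0; rewrite addn0 (mean_cst mu 1) mulr1.
Qed.

Lemma mean_norm2_pert_exp6 s :
  mean (fun w => norm2 (pert w s) ^+ 6) = d%:R * (d%:R + 2) * (d%:R + 4).
Proof.
under eq_fun do rewrite (exprM _ 2 3).
rewrite !mean_norm2_pert_exp (mean_cst mu 1) !natrD !natrM; ring.
Qed.

Lemma mean_coord_dot_pert s (V : W -> 'rV[R]_d) k :
  adapted s V -> poly_growth_rV V ->
  mean (fun w => V w ord0 k * dot (V w) (pert w s) * w (s, k)) =
  mean (fun w => V w ord0 k ^+ 2).
Proof.
move=> adV gV; have -> : (fun w => V w ord0 k ^+ 2) =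
    (fun w => 0 * dot (V w) (pert w s) + V w ord0 k * V w ord0 k).
  by apply/funext => w; rewrite mul0r add0r.
apply: mean_integration_by_parts => //; apply: has_partialM.
  by apply: has_partial_adapted => w w' ww'; rewrite (adV w w').
exact: has_partial_dot_pert.
Qed.

Lemma mean_dot_pert_sqr s (V : W -> 'rV[R]_d) :
  adapted s V -> poly_growth_rV V ->
  mean (fun w => dot (V w) (pert w s) ^+ 2) = mean (fun w => norm2 (V w) ^+ 2).
Proof.
move=> adV gV; have -> : (fun w => dot (V w) (pert w s) ^+ 2) =
    (fun w => \sum_k V w ord0 k * dot (V w) (pert w s) * w (s, k)).
  apply/funext => w; rewrite expr2 {1}/dot mulr_suml; apply: eq_bigr => k _.
  by rewrite mulrAC; congr (_ * _); rewrite mxE.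
rewrite (mean_sum lmu); under eq_bigr do rewrite mean_coord_dot_pert//.
by rewrite -(mean_sum lmu); congr mean; apply/funext => w; rewrite norm2_sqr.
Qed.

Lemma mean_dot_pert_coord_sqr s (V : W -> 'rV[R]_d) k :
  adapted s V -> poly_growth_rV V ->
  mean (fun w => dot (V w) (pert w s) ^+ 2 * w (s, k) ^+ 2) =
  2 * mean (fun w => V w ord0 k ^+ 2) + mean (fun w => norm2 (V w) ^+ 2).
Proof.
move=> adV gV; pose Vz w := dot (V w) (pert w s).
have -> : mean (fun w => Vz w ^+ 2 * w (s, k) ^+ 2) =
    mean (fun w => 2 * Vz w ^+ 1 * V w ord0 k * w (s, k) + Vz w ^+ 2 * 1).
  under eq_fun => w do rewrite [w _ ^+ 2]expr2 mulrA.
  apply: mean_integration_by_parts => //.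
  apply: has_partialM; last exact: has_partial_path_coord.
  by apply: (has_partialX 2); exact: has_partial_dot_pert.
rewrite (meanD lmu); under [X in _ + mean X]eq_fun do rewrite mulr1.
rewrite mean_dot_pert_sqr// -(mean_coord_dot_pert k adV gV) -(meanZ lmu).
by congr (_ + _); congr mean; apply/funext => w; rewrite /Vz; ring.
Qed.

End perturbation.

Section feedback_moments.
Context {R : realType} {d : nat}.
Local Notation W := (path_space R (nat * 'I_d)%type).
Variables (g : 'rV[R]_d -> R) (G L u : R).
Hypotheses (G_ge0 : 0 <= G) (u_gt0 : 0 < u).
Hypotheses (lg : lipschitz2 G g) (sg : smooth2 L g).
Implicit Types (x z : 'rV[R]_d) (w : W) (s t : nat) (k : 'I_d).

Lemma feedback_coord_sqr_le x z k :
  (dquot g u x z * z ord0 k) ^+ 2 <=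
  5 / 4 * (dot (grad g x) z ^+ 2 * z ord0 k ^+ 2) +
  5 / 4 * (L * u) ^+ 2 * norm2 z ^+ 6.
Proof.
set D := dquot g u x z; set a := dot (grad g x) z.
have D_le : D ^+ 2 <= 5 / 4 * a ^+ 2 + 5 * (D - a) ^+ 2.
  by have := sqr_ge0 (a / 2 - 2 * (D - a)); nra.
have err_le : (D - a) ^+ 2 <= (L * u / 2 * norm2 z ^+ 2) ^+ 2.
  have Da := normr_dquot_sub_dot u_gt0 sg x z.
  by rewrite -[leLHS]real_normK ?num_real// lerXn2r ?nnegrE// (le_trans _ Da).
have errM_le : (D - a) ^+ 2 * z ord0 k ^+ 2 <=
    (L * u / 2 * norm2 z ^+ 2) ^+ 2 * norm2 z ^+ 2.
  by rewrite ler_pM ?sqr_ge0 ?sqr_coord_le_norm2.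
rewrite exprMn (le_trans (ler_wpM2r (sqr_ge0 _) D_le))// (exprM _ 2 3).
move: errM_le; move: ((D - a) ^+ 2) (norm2 z ^+ 2) => e N; lra.
Qed.

Variable mu : probability W R.
Hypothesis lmu : gaussian_law mu.
Local Notation mean := (mean mu).
Variables (s : nat) (X : W -> 'rV[R]_d).
Hypotheses (adX : adapted s X) (gX : poly_growth_rV X).

Lemma mean_feedback_coord_sqr_le k :
  5 * (L * u) ^+ 2 * (d%:R * (d%:R + 2) * (d%:R + 4)) <= G ^+ 2 ->
  mean (fun w => (dquot g u (X w) (pert w s) * w (s, k)) ^+ 2) <= 4 * G ^+ 2.
Proof.
move=> u_small; pose gradX w := grad g (X w).
have adgX : adapted s gradX by move=> w w' ww'; rewrite /gradX (adX ww').
have gradX_le w : norm2 (gradX w) ^+ 2 <= G ^+ 2.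
  by apply: norm2_sqr_le; exact: (norm2_grad_le _ G_ge0 sg.1 lg).
have norm_le : mean (fun w => norm2 (gradX w) ^+ 2) <= G ^+ 2.
  by rewrite -[leRHS](mean_cst mu); exact: (ler_mean lmu).
have coord_le : mean (fun w => gradX w ord0 k ^+ 2) <= G ^+ 2.
  rewrite -[leRHS](mean_cst mu); apply: (ler_mean lmu) => w.
  exact: le_trans (sqr_coord_le_norm2 _ _) (gradX_le w).
apply: (@le_trans _ _ (mean (fun w =>
    5 / 4 * (dot (gradX w) (pert w s) ^+ 2 * w (s, k) ^+ 2) +
    5 / 4 * (L * u) ^+ 2 * norm2 (pert w s) ^+ 6))).
  apply: (ler_mean lmu) => w; have := feedback_coord_sqr_le (X w) (pert w s) k.
  by rewrite [pert w s ord0 k]mxE.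
rewrite (meanD lmu) !(meanZ lmu) (mean_dot_pert_coord_sqr lmu)//.
by rewrite (mean_norm2_pert_exp6 lmu); lra.
Qed.

(* Exchanging the perturbations of times s and t does not change the law. *)
Lemma mean_feedback_coord t k (P : W -> R) :
  adapted s P -> poly_growth P -> (s <= t)%N ->
  mean (fun w => P w * (dquot g u (X w) (pert w s) * w (s, k))) =
  mean (fun w => P w * sym_grad g u (X w) (pert w t) ord0 k).
Proof.
move=> adP gP st.
have -> : mean (fun w => P w * sym_grad g u (X w) (pert w t) ord0 k) =
    mean (fun w => P w * sym_grad g u (X w) (pert w s) ord0 k).
  rewrite -[RHS](@mean_reindex _ _ _ lmu _ (fun w => P w *
    sym_grad g u (X w) (pert w s) ord0 k) (swap_timeK s t)).
  apply: eq_Rintegral => w _.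
  by rewrite (adapted_swap w adP st) (adapted_swap w adX st) pert_swap.
under eq_fun do rewrite mulrA.
have -> : (fun w => P w * sym_grad g u (X w) (pert w s) ord0 k) =
    (fun w => 0 * dquot g u (X w) (pert w s) +
              P w * sym_grad g u (X w) (pert w s) ord0 k).
  by apply/funext => w; rewrite mul0r add0r.
apply: (mean_integration_by_parts lmu); apply: has_partialM.
  exact: has_partial_adapted.
have lineE w y : X (upd w (s, k) y) = X w /\ pert (upd w (s, k) y) s =
    pert w s - w (s, k) *: delta_mx ord0 k + y *: delta_mx ord0 k.
  by split; [exact: adapted_upd adX _|exact: pert_upd].
split=> w.
  move=> y; under eq_fun do rewrite (lineE w _).1 (lineE w _).2.
  by rewrite (lineE w y).1 (lineE w y).2; exact: is_derive_dquot.
under eq_fun do rewrite (lineE w _).1 (lineE w _).2.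
by move=> y; exact: (continuous_sym_grad_line sg).
Qed.

End feedback_moments.

(** * The iteration as a function of the perturbations *)

Section zfo_path.
Context {R : realType} {n d : nat}.
Variables (f : 'I_n -> 'rV[R]_d -> R) (eta u : R) (x0 : 'rV[R]_d).
Variables (blk : 'I_d -> 'I_n) (tau : nat -> 'I_n -> 'I_n -> int).
Hypothesis tau_le : forall t i j, tau t i j <= t%:Z.
Local Notation W := (path_space R (nat * 'I_d)%type).
Implicit Types (w : W) (x : nat -> 'rV[R]_d) (s t : nat) (i j : 'I_n).

Definition feedback x w s j : 'rV[R]_d :=
  dquot (f j) u (x s) (pert w s) *: pert w s.

Definition delayed_feedback x w (s : int) j : 'rV[R]_d :=
  if s is Posz r then feedback x w r j else 0.

Definition estimate x w t j : 'rV[R]_d :=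
  splice blk (fun i => delayed_feedback x w (tau t i j) j).

Definition dir x w t : 'rV[R]_d := n%:R^-1 *: \sum_(j < n) estimate x w t j.

(* [hist w t s] is the iterate x(s) for s <= t; a step may read all earlier
   ones. *)
Fixpoint hist w t : nat -> 'rV[R]_d :=
  if t is t'.+1 then fun s => if (s <= t')%N then hist w t' s
    else hist w t' t' - eta *: dir (hist w t') w t'
  else fun=> x0.

Definition pos w t := hist w t t.

Lemma histE w t s : (s <= t)%N -> hist w t s = pos w s.
Proof.
elim: t => [|t IH]; first by rewrite leqn0 => /eqP ->.
rewrite leq_eqVlt => /predU1P[->//|]; rewrite ltnS => st /=.
by rewrite st IH.
Qed.

Lemma delay_cases t i j :
  (exists2 s, tau t i j = s%:Z & (s <= t)%N) \/ (exists s, tau t i j = Negz s).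
Proof.
by have := tau_le t i j; case: (tau t i j) => s st; [left|right]; exists s.
Qed.

Lemma eq_dir x x' w w' t : (forall s, (s <= t)%N -> x s = x' s) ->
  (forall s k, (s <= t)%N -> w (s, k) = w' (s, k)) -> dir x w t = dir x' w' t.
Proof.
move=> xx' ww'; congr (_ *: _); apply: eq_bigr => j _; congr splice.
apply/funext => i; have [[s -> st]|[s ->]//] := delay_cases t i j.
rewrite /= /feedback xx'// (_ : pert w s = pert w' s)//.
by apply/rowP => k; rewrite !mxE ww'.
Qed.

Lemma pos0 w : pos w 0 = x0. Proof. by []. Qed.

Lemma posS w t : pos w t.+1 = pos w t - eta *: dir (pos w) w t.
Proof.
rewrite {1}/pos /= ltnn; congr (_ - _ *: _); apply: eq_dir => // s st.
exact: histE.
Qed.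

Lemma adapted_pos t : adapted t (fun w => pos w t).
Proof.
elim/ltn_ind: t => -[//|t] IH w w' ww'; rewrite !posS.
have eq_pos s : (s <= t)%N -> pos w s = pos w' s.
  move=> st; apply: IH => // r k rs; apply: ww'.
  by rewrite (leq_trans rs)// ltnW.
by rewrite eq_pos//; congr (_ - _ *: _); apply: eq_dir => // s k st; exact: ww'.
Qed.

Lemma pos_sub w s e : pos w (s + e) - pos w s =
  - eta *: \sum_(r < e) dir (pos w) w (s + r).
Proof.
elim: e => [|e IH]; first by rewrite addn0 subrr big_ord0 scaler0.
by rewrite addnS posS big_ord_recr/= scalerDr -IH scaleNr addrAC.
Qed.

Variables (G L : R).
Hypotheses (n_gt0 : (0 < n)%N) (G_gt0 : 0 < G) (L_gt0 : 0 < L).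
Hypotheses (u_gt0 : 0 < u) (eta_gt0 : 0 < eta).
Hypothesis lf : forall i, lipschitz2 G (f i).
Hypothesis sf : forall i, smooth2 L (f i).
Local Notation F := (objective f).

Let G_ge0 : 0 <= G. Proof. exact: ltW. Qed.

#[local] Instance lipschitz2_F : lipschitz2 G F.
Proof. exact: lipschitz2_objective. Qed.

#[local] Instance smooth2_F : smooth2 L F.
Proof. exact: smooth2_objective. Qed.

Lemma poly_growth_dir_of_pos t :
  (forall s, (s <= t)%N -> poly_growth_rV (fun w => pos w s)) ->
  poly_growth_rV (fun w => dir (pos w) w t).
Proof.
move=> gpos; have gdelayed i j :
    poly_growth_rV (fun w => delayed_feedback (pos w) w (tau t i j) j).
  have [[s -> /gpos gs]|[s ->]] := delay_cases t i j;
    rewrite /= /feedback; exact: _.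
exact: _.
Qed.

#[local] Instance poly_growth_pos t : poly_growth_rV (fun w => pos w t).
Proof.
elim/ltn_ind: t => -[|t] IH; first exact: poly_growth_rV_cst.
have gpos : poly_growth_rV (fun w => pos w t) by exact: IH.
have gdir : poly_growth_rV (fun w => dir (pos w) w t).
  by apply: poly_growth_dir_of_pos => s st; exact: IH.
by under eq_fun do rewrite posS; exact: _.
Qed.

#[local] Instance poly_growth_delayed_feedback (s : int) j :
  poly_growth_rV (fun w => delayed_feedback (pos w) w s j).
Proof. by case: s => s; rewrite /= /feedback; exact: _. Qed.

Variable mu : probability W R.
Hypothesis lmu : gaussian_law mu.
Local Notation mean := (mean mu).

Hypothesis u_small :
  5 * (L * u) ^+ 2 * (d%:R * (d%:R + 2) * (d%:R + 4)) <= G ^+ 2.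

Lemma mean_estimate_sqr_le t j :
  mean (fun w => norm2 (estimate (pos w) w t j) ^+ 2) <= 4 * G ^+ 2 * d%:R.
Proof.
under eq_fun do rewrite norm2_sqr.
rewrite (mean_sum lmu) [leRHS]mulrC; apply: sum_ord_le => k.
under eq_fun do rewrite mxE.
have [[s -> st]|[s ->]] := delay_cases t (blk k) j; last first.
  by under eq_fun do rewrite mxE expr0n; rewrite mean_cst mulr_ge0// sqr_ge0.
under eq_fun do rewrite /= mxE [pert _ _ _ _]mxE.
exact: (mean_feedback_coord_sqr_le G_ge0 u_gt0 (lf j) (sf j) lmu
  (@adapted_pos s)).
Qed.

Lemma mean_dir_sqr_le t :
  mean (fun w => norm2 (dir (pos w) w t) ^+ 2) <= 4 * G ^+ 2 * d%:R.
Proof.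
apply: (@le_trans _ _ (mean (fun w =>
    n%:R^-1 * \sum_(j < n) norm2 (estimate (pos w) w t j) ^+ 2))).
  by apply: (ler_mean lmu) => w; exact: norm2_mean_sqr.
rewrite (meanZ lmu) (mean_sum lmu); apply: average_le => // j.
exact: mean_estimate_sqr_le.
Qed.

Lemma mean_pos_sub_sqr_le s e :
  mean (fun w => norm2 (pos w (s + e) - pos w s) ^+ 2) <=
  eta ^+ 2 * e%:R ^+ 2 * (4 * G ^+ 2 * d%:R).
Proof.
apply: (@le_trans _ _ (mean (fun w => eta ^+ 2 * e%:R *
    \sum_(r < e) norm2 (dir (pos w) w (s + r)) ^+ 2))).
  apply: (ler_mean lmu) => w; rewrite pos_sub norm2Z normrN exprMn.
  rewrite real_normK ?num_real// -mulrA ler_wpM2l ?sqr_ge0//.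
  exact: norm2_sum_sqr.
rewrite (meanZ lmu) (mean_sum lmu).
rewrite (_ : eta ^+ 2 * e%:R ^+ 2 * _ =
  eta ^+ 2 * e%:R * (e%:R * (4 * G ^+ 2 * d%:R))); last by ring.
apply: ler_wpM2l; first exact: mulr_ge0 (sqr_ge0 _) (ler0n _ _).
by apply: sum_ord_le => r; exact: mean_dir_sqr_le.
Qed.

Definition descent_error (beta : R) : R :=
  2^-1 * (L * u) ^+ 2 * d%:R + 11 * (L * eta * beta) * G ^+ 2 * d%:R.

Section drift.
Variables (t : nat) (lag : 'I_n -> 'I_n -> nat) (beta : R).
Hypotheses (d_gt0 : (0 < d)%N) (beta_gt0 : 0 < beta).
Hypothesis lagE : forall i j, tau t i j = (lag i j)%:Z.
Hypothesis lag_le :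
  \sum_(i < n) \sum_(j < n) (t - lag i j)%N%:R ^+ 2 <= n%:R * beta ^+ 2 :> R.

Let lag_le_t i j : (lag i j <= t)%N.
Proof. by have := tau_le t i j; rewrite lagE lez_nat. Qed.

Let gradF w := grad F (pos w t).

Definition stale_grad w j := splice blk (fun i => grad F (pos w (lag i j))).

Definition stale_sym_grad w j :=
  splice blk (fun i => sym_grad (f j) u (pos w (lag i j)) (pert w t)).

Definition staleness w j := \sum_(i < n) norm2 (pos w t - pos w (lag i j)) ^+ 2.

Let estimateE w j : estimate (pos w) w t j =
  splice blk (fun i => feedback (pos w) w (lag i j) j).
Proof. by congr splice; apply/funext => i; rewrite lagE. Qed.

Lemma mean_dot_stale_grad j :
  mean (fun w => dot (stale_grad w j) (estimate (pos w) w t j)) =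
  mean (fun w => dot (stale_grad w j) (stale_sym_grad w j)).
Proof.
rewrite !(mean_sum lmu); apply: eq_bigr => k _; set s := lag (blk k) j.
have feedback_coord := @mean_feedback_coord _ _ (f j) _ L u u_gt0 (lf j) (sf j)
  mu lmu s _ (@adapted_pos s) _ t k (fun w => grad F (pos w s) ord0 k).
under eq_fun do
  rewrite estimateE mxE [X in _ * X]mxE -/s [X in _ * X]mxE
    [X in _ * (_ * X)]mxE.
under [X in _ = mean X]eq_fun do rewrite mxE [X in _ * X]mxE -/s.
apply: feedback_coord; last exact: lag_le_t.
by move=> w w' ww'; rewrite (adapted_pos ww').
Qed.

Lemma norm2_sub_stale_grad_sqr w j :
  norm2 (gradF w - stale_grad w j) ^+ 2 <= L ^+ 2 * staleness w j.
Proof.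
rewrite (le_trans (norm2_sub_splice_sqr _ _ _))// mulr_sumr.
apply: ler_sum => i _; rewrite -exprMn; apply: norm2_sqr_le.
exact: (smooth2_F.2).
Qed.

Lemma norm2_sub_stale_sym_grad_sqr w j :
  norm2 (stale_sym_grad w j - sym_grad (f j) u (pos w t) (pert w t)) ^+ 2 <=
  L ^+ 2 * staleness w j.
Proof.
rewrite -norm2N opprB (le_trans (norm2_sub_splice_sqr _ _ _))// mulr_sumr.
apply: ler_sum => i _; rewrite -exprMn; apply: norm2_sqr_le.
exact: sym_grad_lipschitz.
Qed.

Lemma norm2_stale_sym_grad_sqr w j :
  norm2 (stale_sym_grad w j) ^+ 2 <= G ^+ 2 * d%:R.
Proof.
rewrite norm2_sqr [leRHS]mulrC; apply: sum_ord_le => k.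
rewrite mxE -[leLHS]real_normK ?num_real//.
by rewrite lerXn2r ?nnegrE//; exact: normr_sym_grad_le (lf j) (sf j) _ _ _.
Qed.

Lemma norm2_gradF_sqr w : norm2 (gradF w) ^+ 2 <= G ^+ 2 * d%:R.
Proof.
apply: (@le_trans _ _ (G ^+ 2)); last by rewrite ler_peMr ?sqr_ge0// ler1n.
by apply: norm2_sqr_le; apply: norm2_grad_le => //; exact: (smooth2_F.1).
Qed.

Lemma mean_dot_estimate_ge c j : 0 < c ->
  mean (fun w => dot (gradF w) (sym_grad (f j) u (pos w t) (pert w t))) -
    3 / 2 * c * L ^+ 2 * mean (fun w => staleness w j) -
    3 / c * G ^+ 2 * d%:R <=
  mean (fun w => dot (gradF w) (estimate (pos w) w t j)).
Proof.
move=> c_gt0.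
have -> : mean (fun w => dot (gradF w) (estimate (pos w) w t j)) =
    mean (fun w => dot (gradF w - stale_grad w j) (estimate (pos w) w t j) +
                   dot (stale_grad w j) (stale_sym_grad w j)).
  rewrite (meanD lmu) -mean_dot_stale_grad -(meanD lmu); congr mean.
  by apply/funext => w; rewrite dotBl subrK.
apply: (@le_trans _ _ (mean (fun w =>
    dot (gradF w) (sym_grad (f j) u (pos w t) (pert w t)) -
    3 / 2 * c * L ^+ 2 * staleness w j -
    (2 * c)^-1 * (norm2 (estimate (pos w) w t j) ^+ 2 + 2 * (G ^+ 2 * d%:R))))).
  rewrite !(meanB lmu) !(meanZ lmu) (meanD lmu) mean_cst lerD2l lerN2.
  have -> : 3 / c = (2 * c)^-1 * 6 by field; rewrite gt_eqF.
  rewrite -[leRHS]mulrA.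
  rewrite -[leRHS]mulrA ler_wpM2l ?invr_ge0 ?mulr_ge0 ?(ltW c_gt0)//.
  by have := mean_estimate_sqr_le t j; lra.
apply: (ler_mean lmu) => w.
have := dot_perturb_ge (gradF w) (stale_grad w j)
  (sym_grad (f j) u (pos w t) (pert w t)) (stale_sym_grad w j)
  (estimate (pos w) w t j) c_gt0.
have := ler_wpM2l (ltW c_gt0) (norm2_sub_stale_grad_sqr w j).
have := ler_wpM2l (ltW c_gt0) (norm2_sub_stale_sym_grad_sqr w j).
have c_inv : 0 <= (2 * c)^-1 by rewrite invr_ge0 mulr_ge0// ltW.
have := ler_wpM2l c_inv
  (lerD (norm2_stale_sym_grad_sqr w j) (norm2_gradF_sqr w)).
by move: ((2 * c)^-1) => e; lra.
Qed.

Lemma sum_mean_staleness_le :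
  \sum_(j < n) mean (fun w => staleness w j) <=
  4 * (eta * beta) ^+ 2 * G ^+ 2 * d%:R * n%:R.
Proof.
under eq_bigr do rewrite (mean_sum lmu); rewrite exchange_big/=.
apply: (@le_trans _ _ (\sum_(i < n) \sum_(j < n)
    eta ^+ 2 * (4 * G ^+ 2 * d%:R) * (t - lag i j)%N%:R ^+ 2)).
  apply: ler_sum => i _; apply: ler_sum => j _; rewrite mulrAC.
  by have := mean_pos_sub_sqr_le (lag i j) (t - lag i j); rewrite subnKC.
under eq_bigr do rewrite -mulr_sumr; rewrite -mulr_sumr.
rewrite [leRHS](_ : _ = eta ^+ 2 * (4 * G ^+ 2 * d%:R) * (n%:R * beta ^+ 2)).
  by rewrite ler_wpM2l// mulr_ge0 ?sqr_ge0// mulr_ge0// mulr_ge0 ?sqr_ge0.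
by ring.
Qed.

Lemma average_dot_sym_grad_ge :
  2^-1 * mean (fun w => norm2 (gradF w) ^+ 2) - 2^-1 * (L * u) ^+ 2 * d%:R <=
  n%:R^-1 * \sum_(j < n)
    mean (fun w => dot (gradF w) (sym_grad (f j) u (pos w t) (pert w t))).
Proof.
rewrite -(mean_sum lmu) -(meanZ lmu) -(mean_norm2_pert_sqr lmu t).
rewrite -!(meanZ lmu) -(meanB lmu); apply: (ler_mean lmu) => w.
rewrite -dot_sumr -dotZr -(sym_grad_objective _ _ _ sf) -mulrA -exprMn.
exact: dot_grad_sym_grad_ge.
Qed.

Lemma mean_drift_ge :
  2^-1 * mean (fun w => norm2 (gradF w) ^+ 2) -
    (2^-1 * (L * u) ^+ 2 * d%:R + 9 * (L * eta * beta) * G ^+ 2 * d%:R) <=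
  mean (fun w => dot (gradF w) (dir (pos w) w t)).
Proof.
(* This weight balances the two sides of Young's inequality. *)
pose c := (L * eta * beta)^-1.
have c_gt0 : 0 < c by rewrite invr_gt0 !mulr_gt0.
have n_neq0 : n%:R != 0 :> R by rewrite pnatr_eq0 -lt0n.
have ninv_ge0 : 0 <= n%:R^-1 :> R by rewrite invr_ge0.
have -> : mean (fun w => dot (gradF w) (dir (pos w) w t)) = n%:R^-1 *
    \sum_(j < n) mean (fun w => dot (gradF w) (estimate (pos w) w t j)).
  rewrite -(mean_sum lmu) -(meanZ lmu); congr mean; apply/funext => w.
  by rewrite dotZr dot_sumr.
apply: le_trans (ler_wpM2l ninv_ge0
  (ler_sum _ (fun j _ => mean_dot_estimate_ge j c_gt0))).
rewrite !sumrB !mulrBr -mulr_sumr sumr_const card_ord.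
have young_coef_ge0 : 0 <= n%:R^-1 * (3 / 2 * c * L ^+ 2).
  by rewrite !mulr_ge0 ?divr_ge0 ?sqr_ge0// ltW.
have := ler_wpM2l young_coef_ge0 sum_mean_staleness_le.
have -> : n%:R^-1 * (3 / 2 * c * L ^+ 2) *
    (4 * (eta * beta) ^+ 2 * G ^+ 2 * d%:R * n%:R) =
    6 * (L * eta * beta) * G ^+ 2 * d%:R.
  by rewrite /c; field; rewrite n_neq0 !gt_eqF.
have -> : n%:R^-1 * ((3 / c * G ^+ 2 * d%:R) *+ n) =
    3 * (L * eta * beta) * G ^+ 2 * d%:R.
  by rewrite -[(_ * _) *+ n]mulr_natl mulKf// /c invrK.
by have := average_dot_sym_grad_ge; rewrite mulrA; lra.
Qed.

Lemma mean_descent : 1 <= beta ->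
  mean (fun w => F (pos w t.+1)) <= mean (fun w => F (pos w t)) -
    eta / 2 * mean (fun w => norm2 (gradF w) ^+ 2) +
    eta * descent_error beta.
Proof.
move=> beta_ge1; apply: (@le_trans _ _ (mean (fun w =>
    F (pos w t) - eta * dot (gradF w) (dir (pos w) w t) +
    L / 2 * eta ^+ 2 * norm2 (dir (pos w) w t) ^+ 2))).
  apply: (ler_mean lmu) => w.
  have := smooth2_ub (pos w t) (- (eta *: dir (pos w) w t)) smooth2_F.
  rewrite -posS dotNr dotZr norm2N norm2Z exprMn real_normK ?num_real//.
  by rewrite mulrA.
rewrite (meanD lmu) (meanB lmu) !(meanZ lmu).
have L_eta2 : 0 <= L / 2 * eta ^+ 2.
  by rewrite mulr_ge0 ?sqr_ge0// divr_ge0// ltW.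
have := ler_wpM2l L_eta2 (mean_dir_sqr_le t).
have := ler_wpM2l (ltW eta_gt0) mean_drift_ge.
have : L * eta ^+ 2 * (G ^+ 2 * d%:R) <= L * eta ^+ 2 * (G ^+ 2 * d%:R) * beta.
  by rewrite ler_peMr// mulr_ge0 ?mulr_ge0 ?sqr_ge0// ltW.
rewrite /descent_error.
move: (mean (fun w => F (pos w t))) (mean (fun w => dot _ _)) => a b.
move: (mean (fun w => norm2 (gradF w) ^+ 2)) => p.
move: (mean (fun w => norm2 _ ^+ 2)) => q; lra.
Qed.

End drift.

Lemma mean_objective_le t :
  mean (fun w => F (pos w t)) <=
  F x0 + (8^-1 + 8 * (G ^+ 2 * eta * t%:R) ^+ 2 * d%:R).
Proof.
apply: (@le_trans _ _ (mean (fun w =>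
    F x0 + 8^-1 + 2 * G ^+ 2 * norm2 (pos w (0 + t) - pos w 0) ^+ 2))).
  apply: (ler_mean lmu) => w; rewrite add0n pos0.
  have := le_trans (ler_norm _) (lipschitz2_F (pos w t) x0).
  have := sqr_ge0 (G * norm2 (pos w t - x0) - 4^-1); nra.
rewrite (meanD lmu) mean_cst (meanZ lmu) -addrA !lerD2l.
have := ler_wpM2l (mulr_ge0 (ler0n R 2) (sqr_ge0 G)) (mean_pos_sub_sqr_le 0 t).
by move/le_trans; apply; lra.
Qed.

Variables (b : 'I_n -> 'I_n -> nat) (B : nat) (beta Fs : R).
Hypotheses (d_gt0 : (0 < d)%N) (beta_ge1 : 1 <= beta).
Hypothesis delay_le : forall t i j, t%:Z - tau t i j <= (b i j)%:Z.
Hypothesis b_le : forall i j, (b i j <= B)%N.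
Hypothesis sum_b_sqr :
  \sum_(i < n) \sum_(j < n) (b i j)%:R ^+ 2 <= n%:R * beta ^+ 2 :> R.
Hypothesis Fs_le : forall v, Fs <= F v.

Lemma mean_descent_ge t : (B <= t)%N ->
  mean (fun w => F (pos w t.+1)) <= mean (fun w => F (pos w t)) -
    eta / 2 * mean (fun w => norm2 (grad F (pos w t)) ^+ 2) +
    eta * descent_error beta.
Proof.
move=> Bt; have beta_gt0 : 0 < beta by exact: lt_le_trans beta_ge1.
pose lag i j := `|tau t i j|%N.
have lagE i j : tau t i j = (lag i j)%:Z.
  by move: (delay_le t i j) (b_le i j) Bt; rewrite /lag; clear; lia.
apply: (mean_descent d_gt0 beta_gt0 lagE) => //; apply: le_trans sum_b_sqr.
apply: ler_sum => i _; apply: ler_sum => j _.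
rewrite lerXn2r ?nnegrE// ler_nat.
by move: (delay_le t i j); rewrite lagE; clear; lia.
Qed.

Lemma sum_mean_grad_sqr_le T : (B <= T)%N ->
  eta / 2 *
    \sum_(B <= t < T.+1) mean (fun w => norm2 (grad F (pos w t)) ^+ 2) <=
  F x0 - Fs + (8^-1 + 8 * (G ^+ 2 * eta * B%:R) ^+ 2 * d%:R) +
  (T.+1 - B)%N%:R * (eta * descent_error beta).
Proof.
move=> BT; set err := eta * descent_error beta.
pose meanF t := mean (fun w => F (pos w t)).
have meanF_ge : Fs <= meanF T.+1.
  by rewrite -(mean_cst mu Fs); exact: (ler_mean lmu).
have := mean_objective_le B; rewrite -/(meanF B).
have : eta / 2 *
      \sum_(B <= t < T.+1) mean (fun w => norm2 (grad F (pos w t)) ^+ 2) <=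
    \sum_(B <= t < T.+1) (meanF t - meanF t.+1 + err).
  rewrite mulr_sumr; apply: ler_sum_nat => t /andP[Bt _].
  have := mean_descent_ge Bt; rewrite -/(meanF t) -/(meanF t.+1) -/err.
  by move: (meanF t) (meanF t.+1) (mean _) (err) => a a' g r; lra.
rewrite big_split/= sumr_const_nat -mulr_natl.
under [X in _ <= X + _ -> _]eq_bigr do rewrite -opprB.
by rewrite sumrN telescope_sumr ?(leqW BT)//; lra.
Qed.

(* The gap and the start cost at most 5/24 of (T - B + 1) eta eps, and the
   descent errors 25/96 of it, which is less than 1/2 in total. *)
Lemma sum_mean_grad_sqr_le_eps (eps M : R) T : (B <= T)%N -> 0 < eps ->
  F x0 - Fs <= M -> 1 <= M -> 6 * M <= (T.+1 - B)%N%:R * (eta * eps) ->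
  16 * ((L * u) ^+ 2 * d%:R) <= eps ->
  48 * (L * eta * beta * G ^+ 2 * d%:R) <= eps ->
  8 * (G ^+ 2 * eta * B%:R * d%:R) <= 1 ->
  \sum_(B <= t < T.+1) mean (fun w => norm2 (grad F (pos w t)) ^+ 2) <=
  (T.+1 - B)%N%:R * eps.
Proof.
move=> BT eps_gt0 gapM M_ge1 M_le u_le eta_le B_le.
have start_le : 8 * (G ^+ 2 * eta * B%:R) ^+ 2 * d%:R <= 8^-1.
  set v := G ^+ 2 * eta * B%:R in B_le *.
  have v_ge0 : 0 <= v by rewrite !mulr_ge0 ?sqr_ge0// ltW.
  have v_le : v <= v * d%:R by rewrite ler_peMr// ler1n.
  have vd_le : v * d%:R <= 8^-1 by lra.
  have vd_ge0 := mulr_ge0 v_ge0 (ler0n R d).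
  have := ler_pM v_ge0 vd_ge0 (le_trans v_le vd_le) vd_le.
  by rewrite expr2; lra.
have error_le : descent_error beta <= 25 / 96 * eps.
  by rewrite /descent_error; lra.
rewrite -(@ler_pM2l _ (eta / 2)) ?divr_gt0//.
have := ler_wpM2l (ler0n R (T.+1 - B)) (ler_wpM2l (ltW eta_gt0) error_le).
have := sum_mean_grad_sqr_le BT.
move: (\sum_(_ <= _ < _) _) (descent_error beta) => S err.
by move: (T.+1 - B)%N%:R M_le => N; lra.
Qed.

End zfo_path.

(** * From runs of the algorithm to paths *)

Section transfer.
Context {dsp : measure_display} {Omega : measurableType dsp} {R : realType}.
Variable P : probability Omega R.
Variables (n : nat) (dim : 'I_n -> nat) (e : rel 'I_n).
Local Notation d := (\sum_(i < n) dim i)%N.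
Variables (f : 'I_n -> 'rV[R]_d -> R) (eta u : R) (x0 : 'rV[R]_d).
Variables (recv : nat -> 'I_n -> nat -> 'I_n -> bool).
Variables (Z : nat -> 'I_d -> {RV P >-> R}).
Variables (xi : bool -> nat -> 'I_n -> {RV P >-> R}).
Variables (D : nat -> 'I_n -> 'I_n -> Omega -> R).
Variables (tau : nat -> 'I_n -> 'I_n -> int) (x : nat -> Omega -> 'rV[R]_d).
Hypothesis run : zfo_run e f eta u 0 x0 recv Z xi D tau x.
Local Notation W := (path_space R (nat * 'I_d)%type).
Local Notation pos := (pos f eta u x0 tagnat.sig1 tau).

Lemma zfo_pair t i j : tau t i j = -1 \/
  exists s, [/\ (s <= t)%N, tau t i j = s%:Z & D t i j = D s j j].
Proof.
elim/ltn_ind: t i j => t IH i j.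
have [<-|ji] := eqVneq j i.
  by right; exists t; split => //; exact: (zfo_own run t j).2.
have [[k _ [[s [st _ [-> ->]]]|[_ prev]]] _] := zfo_adopt run t ji.
  have [->|[r [rs -> ->]]] := IH s st k j; [by left|right].
  by exists r; split => //; exact: leq_trans rs (ltnW st).
case: t IH prev => [|t] IH /= prev; case: prev => -> ->; first by left.
have [->|[r [rt -> ->]]] := IH t (ltnSn t) i j; [by left|right].
by exists r; split => //; exact: leqW.
Qed.

Lemma zfo_tau_le t i j : tau t i j <= t%:Z.
Proof. by have [->//|[s [st -> _]]] := zfo_pair t i j; rewrite lez_nat. Qed.

Definition noise_path (w : Omega) : W := fun a => Z a.1 a.2 w.

Lemma measurable_noise_path : measurable_fun setT noise_path.
Proof. by apply: measurable_path => a; exact: measurable_funPT. Qed.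

Definition noise_path_mfun : {mfun Omega >-> W} :=
  HB.pack noise_path (isMeasurableFun.Build _ _ _ _ _ measurable_noise_path).

Definition noise_law : probability W R := distribution P noise_path_mfun.

Lemma gaussian_noise_law : gaussian_law noise_law.
Proof.
move=> s A us mA.
pose index (a : nat * 'I_d) : (nat * 'I_d) + (bool * nat * 'I_n) := inl a.
pose A' (b : (nat * 'I_d) + (bool * nat * 'I_n)) : set R :=
  if b is inl a then A a else setT.
have mA' b : measurable (A' b).
  by case: b => [a|b]; [exact: mA|exact: measurableT].
have us' : uniq (map index s) by rewrite map_inj_uniq// => a b [].
have := zfo_indep run us' mA'; rewrite big_map => indep.
transitivity
  (P (\bigcap_(a in [set` map index s]) (randomness Z xi a @^-1` A' a))).
  rewrite /noise_law /distribution /pushforward/=; congr (P _).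
  apply/seteqP; split=> [w sA b /= /mapP[[t k] as_ ->]|w sA [t k] as_].
    exact: sA as_.
  exact: (sA (index (t, k)) (map_f index as_)).
rewrite indep; apply: eq_bigr => -[t k] _ /=.
by rewrite -(zfo_normal run t k (mA (t, k))).
Qed.

Lemma zfo_noise_ae0 : {ae P, forall w s t i, xi s t i w = 0}.
Proof.
have xi_ae0 s t i : {ae P, forall w, xi s t i w = 0}.
  have := zfo_noise_var run s t i; rewrite expr0n/= /variance covariance.unlock.
  rewrite (zfo_noise_mean run) expectation.unlock/= => var_le0.
  have mxi2 : measurable_fun setT (fun w => (xi s t i w ^+ 2)%:E).
    by apply/measurable_EFinP/measurable_funX; exact: measurable_funPT.
  have : (\int[P]_w `|(xi s t i w ^+ 2)%:E| = 0)%E.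
    apply/eqP; rewrite eq_le integral_ge0// andbT; apply: le_trans var_le0.
    rewrite le_eqVlt; apply/orP; left; apply/eqP; apply: eq_integral => w _.
    by rewrite gee0_abs ?lee_fin ?sqr_ge0//= !fctE/= subr0 expr2.
  move/(ae_eq_integral_abs _ measurableT mxi2).
  by apply: filterS => w /(_ I) /= [] /eqP; rewrite sqrf_eq0 => /eqP.
have : {ae P, forall w (N : nat),
    if (unpickle N : option (bool * nat * 'I_n)) is Some p
    then xi p.1.1 p.1.2 p.2 w = 0 else True}.
  apply: ae_foralln => N; case: unpickle => [p|]; last exact: aeW.
  exact: xi_ae0.
apply: filterS => w xi0 s t i; have := xi0 (pickle (s, t, i)).
by rewrite pickleK.
Qed.

Lemma zfo_dirE t w k : zfo_dir Z D tau t w ord0 k = n%:R^-1 * \sum_(j < n)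
  D t (tagnat.sig1 k) j w * zvec Z (tau t (tagnat.sig1 k) j) w ord0 k.
Proof.
rewrite mxE mxE summxE; congr (_ * _); apply: eq_bigr => j _.
by rewrite mxE [X in _ * X]mxE tagnat.sig2K.
Qed.

Lemma zfo_pos w : (forall s t i, xi s t i w = 0) ->
  forall t, x t w = pos (noise_path w) t.
Proof.
move=> xi0; elim/ltn_ind => -[_|t IH]; first exact: zfo_init run w.
rewrite (zfo_step run) (posS _ _ _ _ _ zfo_tau_le) IH//; congr (_ - _ *: _).
apply/rowP => k; rewrite zfo_dirE [RHS]mxE summxE; congr (_ * _).
apply: eq_bigr => j _; rewrite [RHS]mxE.
have [->|[s [st -> ->]]] := zfo_pair t (tagnat.sig1 k) j.
  by rewrite /= !mxE mulr0.
rewrite (zfo_own run s j).1 /zfo_diff !xi0 !addr0 IH//= [RHS]mxE.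
by congr (_ * _); rewrite !mxE.
Qed.

Hypothesis cf : forall i, continuous (f i).

Lemma measurable_zvec s : measurable_rV (fun w => zvec Z s w).
Proof.
move=> k; case: s => s; under eq_fun do rewrite mxE; last exact: measurable_cst.
exact: measurable_funPT.
Qed.

Lemma measurable_zfo_diff t j :
  measurable_rV (x t) -> measurable_fun setT (zfo_diff f u Z xi x t j).
Proof.
move=> mx; have measurable_obs c :
    measurable_fun setT (fun w => f j (x t w + c *: zvec Z t w)).
  apply: measurable_continuous_rV (@cf j) _; apply: measurable_rVD => //.
  by apply: measurable_rVZ; [exact: measurable_cst|exact: measurable_zvec].
apply: measurable_funM => //; apply: measurable_funB.
  by apply: measurable_funD; [exact: measurable_obs|exact: measurable_funPT].
under eq_fun do rewrite -scaleNr.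
by apply: measurable_funD; [exact: measurable_obs|exact: measurable_funPT].
Qed.

Lemma measurable_zfo t : measurable_rV (x t).
Proof.
elim/ltn_ind: t => -[_|t IH] k.
  by under eq_fun do rewrite (zfo_init run); exact: measurable_cst.
under eq_fun do
  rewrite (zfo_step run) mxE [X in _ + X]mxE [X in - X]mxE zfo_dirE.
apply: measurable_funB; first exact: IH.
do 2 apply: measurable_funM => //.
apply: measurable_sum => j.
have [->|[s [st -> ->]]] := zfo_pair t (tagnat.sig1 k) j.
  by under eq_fun do rewrite [zvec _ _ _ _ _]mxE mulr0; exact: measurable_cst.
apply: measurable_funM; last exact: measurable_zvec.
by rewrite (zfo_own run s j).1; apply: measurable_zfo_diff; exact: IH.
Qed.

Lemma expectation_zfo (g : 'rV[R]_d -> R) t :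
  continuous g -> (forall v, 0 <= g v) ->
  measurable_rV (fun w : W => pos w t) ->
  ('E_P[fun w => g (x t w)] = \int[noise_law]_w (g (pos w t))%:E)%E.
Proof.
move=> cg g_ge0 mpos; rewrite expectation.unlock.
have mg := measurable_continuous_rV cg mpos.
rewrite (ge0_integral_distribution noise_path_mfun
  (f := fun w => (g (pos w t))%:E)).
- apply: ae_eq_integral => //.
  + apply/measurable_EFinP; apply: (measurable_continuous_rV cg).
    exact: measurable_zfo.
  + apply/measurable_EFinP; apply: (measurableT_comp mg).
    exact: measurable_noise_path.
  + by apply: filterS zfo_noise_ae0 => w xi0 _ /=; rewrite (zfo_pos xi0).
- exact/measurable_EFinP.
- by move=> w; rewrite lee_fin.
Qed.

End transfer.

(** * Delays and parameters *)

Lemma gdist_gt0 (n : nat) (e : rel 'I_n) (i j : 'I_n) :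
  i != j -> (0 < gdist e i j)%N.
Proof.
case: n e i j => [? []//|n] e i j ij; rewrite /gdist /=.
case: ifPn => // /existsP[p /andP[_]].
by rewrite tuple0/= (negbTE ij).
Qed.

Lemma gdist_le_Bmax (n : nat) (e : rel 'I_n) (Delta : nat) (i j : 'I_n) :
  (gdist e i j + Delta <= Bmax e Delta)%N.
Proof.
rewrite /Bmax leq_add2r; apply: leq_trans (leq_bigmax i).
exact: (leq_bigmax j).
Qed.

Section bbar.
Context {R : realType} {n : nat}.
Variables (e : rel 'I_n) (Delta : nat).
Local Notation bb := (bbar R e Delta).
Hypothesis bb_gt0 : 0 < bb.

Let sum_sqr := (\sum_(i < n) \sum_(j < n) (gdist e i j + Delta) ^ 2)%N.

Let sum_sqrE :
  \sum_(i < n) \sum_(j < n) (gdist e i j + Delta)%:R ^+ 2 = sum_sqr%:R :> R.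
Proof.
rewrite natr_sum; apply: eq_bigr => i _; rewrite natr_sum.
by apply: eq_bigr => j _; rewrite natrX.
Qed.

Let sum_sqr_gt0 : (0 < sum_sqr)%N.
Proof.
rewrite lt0n; apply: contraTneq bb_gt0 => sum0.
by rewrite /bbar sum_sqrE sum0 mul0r sqrtr0 ltxx.
Qed.

Lemma bbar_gt0_card : (0 < n)%N.
Proof.
rewrite lt0n; apply: contraTneq sum_sqr_gt0; rewrite /sum_sqr.
by case: n e => // e' _; rewrite big_ord0.
Qed.

Lemma Bmax_gt0 : (0 < Bmax e Delta)%N.
Proof.
rewrite lt0n; apply: contraTneq sum_sqr_gt0 => B0.
rewrite -leqNgt leqn0 /sum_sqr big1// => i _; rewrite big1// => j _.
by have := gdist_le_Bmax e Delta i j; rewrite B0 leqn0 => /eqP ->.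
Qed.

Lemma sum_delay_sqr :
  \sum_(i < n) \sum_(j < n) (gdist e i j + Delta)%:R ^+ 2 =
  n%:R * (bb * Num.sqrt n%:R) ^+ 2 :> R.
Proof.
have n_neq0 : n%:R != 0 :> R by rewrite pnatr_eq0 -lt0n bbar_gt0_card.
rewrite exprMn /bbar sum_sqrE !sqr_sqrtr ?divr_ge0 ?sqr_ge0//.
by field.
Qed.

Lemma bbar_sqrt_ge1 : 1 <= bb * Num.sqrt n%:R.
Proof.
have n_gt0 := bbar_gt0_card.
rewrite -(@ler_pXn2r _ 2) ?nnegrE ?mulr_ge0 ?sqrtr_ge0 ?(ltW bb_gt0)// expr1n.
rewrite -(@ler_pM2l _ n%:R) ?ltr0n// -sum_delay_sqr sum_sqrE mulr1 ler_nat.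
have [n1|n1] := leqP n 1; first exact: leq_trans n1 sum_sqr_gt0.
rewrite -[leqLHS]card_ord -sum1_card; apply: leq_sum => i _.
have [j ij] : exists j : 'I_n, i != j.
  have [->|i0] := eqVneq i (Ordinal n_gt0); first by exists (Ordinal n1).
  by exists (Ordinal n_gt0).
rewrite (bigD1 j)//= (leq_trans _ (leq_addr _ _))// expn_gt0 addn_gt0.
by rewrite gdist_gt0.
Qed.

End bbar.

Lemma nondegenerate_parameters (R : realType) (n d : nat) (e : rel 'I_n)
    (Delta : nat) (f : 'I_n -> 'rV[R]_d -> R) (G L : R) :
  (forall i, lipschitz2 G (f i)) ->
  0 < 48 * L * G ^+ 2 * bbar R e Delta * Num.sqrt n%:R * d%:R ->
  [/\ 0 < G, 0 < L, 0 < bbar R e Delta & (0 < d)%N].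
Proof.
move=> lf; set bb := bbar R e Delta => den_gt0.
have [] : [/\ G != 0, bb != 0 & (0 < d)%N].
  split; [| |rewrite lt0n]; apply: contraTneq den_gt0 => ->;
  by rewrite ?expr0n/= !(mulr0, mul0r) ltxx.
move=> G_neq0 bb_neq0 d_gt0.
have bb_gt0 : 0 < bb by rewrite lt_neqAle eq_sym bb_neq0 sqrtr_ge0.
have n_gt0 := bbar_gt0_card bb_gt0.
have G_gt0 : 0 < G.
  have := le_trans (normr_ge0 _)
    (lf (Ordinal n_gt0) (delta_mx ord0 (Ordinal d_gt0)) 0).
  by rewrite subr0 norm2_delta mulr1 le_eqVlt eq_sym (negbTE G_neq0).
split => //; rewrite ltNge; apply: contraTN den_gt0 => L_le0.
rewrite -leNgt -!mulrA mulrCA mulr_le0_ge0// !mulr_ge0 ?sqrtr_ge0//; exact: ltW.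
Qed.

Lemma eventually_linear_le (R : realType) (a c : R) :
  0 < c -> \forall e \near 0^'+, a * e <= c.
Proof.
move=> c_gt0; near=> e.
have e_gt0 : 0 < e by near: e; exact: nbhs_right_gt.
have a1 : 0 < `|a| + 1 by rewrite ltr_wpDl.
have e_le : e <= c / (`|a| + 1).
  by near: e; apply: nbhs_right_le; exact: divr_gt0.
rewrite (le_trans (ler_wpM2r (ltW e_gt0) (_ : a <= `|a| + 1)))//.
  by rewrite (le_trans (ler_norm a))// lerDl.
by rewrite mulrC -ler_pdivlMr.
Unshelve. all: by end_near. Qed.

Lemma near_right0_ex (R : realType) (A : R -> Prop) :
  (\forall e \near 0^'+, A e) ->
  exists2 e0, 0 < e0 & forall e, 0 < e -> e <= e0 -> A e.
Proof.
case=> r /= r_gt0 rA; exists (r / 2) => [|e e_gt0 er]; first exact: divr_gt0.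
apply: rA => //=; rewrite sub0r normrN gtr0_norm// (le_lt_trans er)//.
by rewrite ltr_pdivrMr// ltr_pMr// ltr1n.
Qed.

Lemma accuracy_threshold (R : realType) (G L beta : R) (d B : nat) :
  0 < G -> 0 < L -> 0 < beta -> (0 < d)%N ->
  exists2 eps0, 0 < eps0 & forall eps, 0 < eps -> eps <= eps0 ->
    [/\ 5 * (d%:R + 2) * (d%:R + 4) * eps <= 16 * G ^+ 2,
        B%:R * eps <= 6 * L * beta & B%:R * eps ^+ 2 <= beta * d%:R].
Proof.
move=> G_gt0 L_gt0 beta_gt0 d_gt0; apply: near_right0_ex; near=> eps.
have eps_gt0 : 0 < eps by near: eps; exact: nbhs_right_gt.
split.
- near: eps; apply: eventually_linear_le; rewrite mulr_gt0//.
  exact: exprn_gt0.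
- by near: eps; apply: eventually_linear_le; rewrite !mulr_gt0.
have eps_le1 : eps <= 1 by near: eps; exact: nbhs_right_le.
rewrite (@le_trans _ _ (B%:R * eps))//.
  by rewrite ler_wpM2l// expr2 ler_piMr// ltW.
by near: eps; apply: eventually_linear_le; rewrite mulr_gt0 ?ltr0n.
Unshelve. all: by end_near. Qed.

Lemma radius_sqr_le (R : realType) (L u eps : R) (d : nat) :
  0 < L -> 0 < u -> 0 < eps -> (0 < d)%N ->
  u <= Num.sqrt eps / (4 * L * Num.sqrt d%:R) ->
  16 * ((L * u) ^+ 2 * d%:R) <= eps.
Proof.
move=> L_gt0 u_gt0 eps_gt0 d_gt0.
rewrite ler_pdivlMr ?mulr_gt0 ?sqrtr_gt0 ?ltr0n// => u_le.
have u_ge0 : 0 <= u * (4 * L * Num.sqrt d%:R).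
  by rewrite !mulr_ge0 ?sqrtr_ge0 ?ltW.
have := ler_pM u_ge0 u_ge0 u_le u_le.
rewrite -!expr2 sqr_sqrtr ?(ltW eps_gt0)// !exprMn sqr_sqrtr//.
by apply: le_trans; rewrite le_eqVlt; apply/orP; left; apply/eqP; ring.
Qed.

Lemma horizon_ge (R : realType) (M q : R) (B T : nat) : 0 < q -> (B <= T)%N ->
  Num.ceil (6 / q * M) <= (T - B + 1)%N%:Z -> 6 * M <= (T.+1 - B)%N%:R * q.
Proof.
move=> q_gt0 BT; rewrite ceil_le_int -pmulrn addn1 -subSn//.
by rewrite mulrAC ler_pdivrMr.
Qed.

Lemma iteration_count (R : realType) (M K eps : R) (B T : nat) :
  (0 < B)%N -> (B <= T)%N -> 0 < eps -> B%:R * eps ^+ 2 <= K ->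
  Num.ceil (M * (K / eps ^+ 2)) = (T - B + 1)%N%:Z ->
  M * (K / eps ^+ 2) <= T%:R /\ T%:R <= (M + 1) * (K / eps ^+ 2).
Proof.
move=> B_gt0 BT eps_gt0 BK; set Q := M * _ => ceilQ.
have BK' : B%:R <= K / eps ^+ 2 by rewrite ler_pdivlMr ?exprn_gt0.
have TB : (T - B + 1)%N%:R = T%:R - B%:R + 1 :> R by rewrite natrD natrB.
have B_ge1 : 1 <= B%:R :> R by rewrite ler1n.
have := ceil_itv Q; rewrite ceilQ intrB mulr1z -pmulrn TB => /andP[lo hi].
by rewrite mulrDl mul1r -/Q; split; lra.
Qed.

Section convergence.
Context {R : realType} {n : nat} (dim : 'I_n -> nat) (e : rel 'I_n).
Variables (Delta : nat).
Local Notation d := (\sum_(i < n) dim i)%N.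
Variables (f : 'I_n -> 'rV[R]_d -> R) (x0 : 'rV[R]_d) (G L eps eta u : R).
Variable T : nat.
Local Notation F := (objective f).
Local Notation Fs := (inf (range F)).
Local Notation B := (Bmax e Delta).
Local Notation beta := (bbar R e Delta * Num.sqrt n%:R).
Hypotheses (G_gt0 : 0 < G) (L_gt0 : 0 < L) (bb_gt0 : 0 < bbar R e Delta).
Hypotheses (d_gt0 : (0 < d)%N) (eps_gt0 : 0 < eps) (eta_gt0 : 0 < eta).
Hypotheses (u_gt0 : 0 < u) (BT : (B <= T)%N).
Hypothesis lf : forall i, lipschitz2 G (f i).
Hypothesis sf : forall i, smooth2 L (f i).
Hypothesis lbF : has_lbound (range F).
Hypothesis eta_le : eta <= eps /
  (48 * L * G ^+ 2 * bbar R e Delta * Num.sqrt n%:R * d%:R).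
Hypothesis u_le : u <= Num.sqrt eps / (4 * L * Num.sqrt d%:R).
Hypothesis T_ge :
  Num.ceil (6 / (eta * eps) * Num.max (F x0 - Fs) 1) <= (T - B + 1)%N%:Z.
Hypothesis eps_moment : 5 * (d%:R + 2) * (d%:R + 4) * eps <= 16 * G ^+ 2.
Hypothesis eps_start : B%:R * eps <= 6 * L * beta.

Let n_gt0 : (0 < n)%N. Proof. exact: bbar_gt0_card bb_gt0. Qed.

Let beta_ge1 : 1 <= beta. Proof. exact: bbar_sqrt_ge1. Qed.

Let beta_gt0 : 0 < beta. Proof. exact: lt_le_trans beta_ge1. Qed.

Lemma step_size_le : 48 * (L * eta * beta * G ^+ 2 * d%:R) <= eps.
Proof.
have -> : 48 * (L * eta * beta * G ^+ 2 * d%:R) =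
    eta * (48 * L * G ^+ 2 * bbar R e Delta * Num.sqrt n%:R * d%:R) by ring.
have sqrtn_gt0 : 0 < Num.sqrt n%:R :> R by rewrite sqrtr_gt0 ltr0n.
by rewrite -ler_pdivlMr// !mulr_gt0 ?ltr0n.
Qed.

Lemma small_radius :
  5 * (L * u) ^+ 2 * (d%:R * (d%:R + 2) * (d%:R + 4)) <= G ^+ 2.
Proof.
have dd_ge0 : 0 <= 5 * (d%:R + 2) * (d%:R + 4) :> R.
  by rewrite !mulr_ge0 ?addr_ge0.
have := ler_wpM2l dd_ge0 (radius_sqr_le L_gt0 u_gt0 eps_gt0 d_gt0 u_le).
by move: eps_moment; move: ((L * u) ^+ 2) (d%:R : R) => q r; lra.
Qed.

Lemma small_start : 8 * (G ^+ 2 * eta * B%:R * d%:R) <= 1.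
Proof.
have coef_ge0 : 0 <= 8 * (G ^+ 2 * eta * d%:R).
  by rewrite !mulr_ge0 ?sqr_ge0// ltW.
rewrite -(@ler_pM2r _ eps)// mul1r; apply: le_trans step_size_le.
have := ler_wpM2l coef_ge0 eps_start.
by move: (bbar R e Delta * _) => beta; lra.
Qed.

Section run.
Context {dsp : measure_display} {Omega : measurableType dsp}.
Variable P : probability Omega R.
Variables (recv : nat -> 'I_n -> nat -> 'I_n -> bool).
Variables (Z : nat -> 'I_d -> {RV P >-> R}).
Variables (xi : bool -> nat -> 'I_n -> {RV P >-> R}).
Variables (D : nat -> 'I_n -> 'I_n -> Omega -> R).
Variables (tau : nat -> 'I_n -> 'I_n -> int) (x : nat -> Omega -> 'rV[R]_d).
Hypothesis run : zfo_run e f eta u 0 x0 recv Z xi D tau x.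
Hypothesis delay : forall t i j, t%:Z - tau t i j <= (gdist e i j + Delta)%N%:Z.
Local Notation pos := (pos f eta u x0 tagnat.sig1 tau).

Lemma expectation_zfo_grad t :
  'E_P[fun w => (norm2 (grad F (x t w)) ^+ 2)%R]%E =
  (mean (noise_law Z) (fun w => norm2 (grad F (pos w t)) ^+ 2))%:E.
Proof.
have tau_le := zfo_tau_le run.
have gpos := poly_growth_pos eta u x0 tagnat.sig1 tau_le lf t.
have sF : smooth2 L F by exact: smooth2_objective.
rewrite (expectation_zfo run _ (continuous_norm2_grad_sqr sF)).
- by rewrite (meanE (gaussian_noise_law run)).
- by move=> i; exact: lipschitz2_continuous (lf i).
- by move=> v; rewrite sqr_ge0.
- exact: poly_growth_rV_measurable.
Qed.

Lemma zfo_convergence :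
  (((T - B + 1)%N%:R^-1)%:E *
     \sum_(B <= t < T.+1) 'E_P[fun w => (norm2 (grad F (x t w)) ^+ 2)%R]
   <= eps%:E)%E.
Proof.
under eq_bigr do rewrite expectation_zfo_grad.
rewrite sumEFin addn1 -subSn// -EFinM lee_fin.
rewrite ler_pdivrMl ?ltr0n ?subn_gt0 ?ltnS//.
have sum_delay : \sum_(i < n) \sum_(j < n) (gdist e i j + Delta)%:R ^+ 2 <=
    n%:R * beta ^+ 2 :> R by rewrite sum_delay_sqr.
have Fs_le v : Fs <= F v by apply: ge_inf => //; exists v.
apply: (sum_mean_grad_sqr_le_eps _ (zfo_tau_le run) n_gt0 G_gt0 L_gt0 u_gt0
  eta_gt0 lf sf (gaussian_noise_law run) small_radius d_gt0 beta_ge1 delay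
  (gdist_le_Bmax e Delta) sum_delay Fs_le BT eps_gt0 _ _
  (horizon_ge (mulr_gt0 eta_gt0 eps_gt0) BT T_ge)
  (radius_sqr_le L_gt0 u_gt0 eps_gt0 d_gt0 u_le) step_size_le small_start).
  by rewrite le_max lexx.
by rewrite le_max lexx orbT.
Qed.

End run.
End convergence.

Theorem theorem3 (R : realType) (G L gap : R) :
  exists c1 c2 : R, [/\ 0 < c1, 0 < c2 &
  forall (n : nat) (dim : 'I_n -> nat) (e : rel 'I_n) (Delta : nat)
    (f : 'I_n -> 'rV[R]_(\sum_(i < n) dim i) -> R)
    (x0 : 'rV[R]_(\sum_(i < n) dim i)),
  let d := (\sum_(i < n) dim i)%N in
  let F := objective f in
  let Fstar := inf (range F) in
  let bb := bbar R e Delta in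
  let B := Bmax e Delta in
  connected_graph e ->
  (forall i, lipschitz2 G (f i)) ->
  (forall i, smooth2 L (f i)) ->
  has_lbound (range F) ->
  F x0 - Fstar = gap ->
  exists2 eps0 : R, 0 < eps0 &
  forall (eps eta u : R) (T : nat),
  0 < eps -> eps <= eps0 -> 0 < eta -> 0 < u -> (B <= T)%N ->
  let eta_max : R := eps / (48 * L * G ^+ 2 * bb * Num.sqrt n%:R * d%:R) in
  let u_max : R := Num.sqrt eps / (4 * L * Num.sqrt d%:R) in
  let T_min := Num.ceil (6 / (eta * eps) * Num.max (F x0 - Fstar) 1) in
  (eta <= eta_max -> u <= u_max -> T_min <= (T - B + 1)%N%:Z ->
   forall (dsp : measure_display) (Omega : measurableType dsp)
     (P : probability Omega R) (sigma : R)
     (recv : nat -> 'I_n -> nat -> 'I_n -> bool)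
     (Z : nat -> 'I_(\sum_(i < n) dim i) -> {RV P >-> R})
     (xi : bool -> nat -> 'I_n -> {RV P >-> R})
     (D : nat -> 'I_n -> 'I_n -> Omega -> R)
     (tau : nat -> 'I_n -> 'I_n -> int)
     (x : nat -> Omega -> 'rV[R]_(\sum_(i < n) dim i)),
   zfo_run e f eta u sigma x0 recv Z xi D tau x ->
   sigma = 0 ->
   (forall t i j, t%:Z - tau t i j <= (gdist e i j + Delta)%N%:Z) ->
   (((T - B + 1)%N%:R^-1)%:E *
      \sum_(B <= t < T.+1) 'E_P[fun w => (norm2 (grad F (x t w)) ^+ 2)%R]
    <= eps%:E)%E)
  /\
  (eta = eta_max -> u = u_max -> T_min = (T - B + 1)%N%:Z ->
   c1 * (bb * Num.sqrt n%:R * d%:R / eps ^+ 2) <= T%:R /\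
   T%:R <= c2 * (bb * Num.sqrt n%:R * d%:R / eps ^+ 2))].
Proof.
pose M := 288 * L * G ^+ 2 * Num.max gap 1; pose c := if 0 < M then M else 1.
have c_gt0 : 0 < c by rewrite /c; case: ifP.
exists c, (c + 1); split=> //; first exact: addr_gt0.
move=> n dim e Delta f x0 d F Fstar bb B _ lf sf lbF gapE.
pose den := 48 * L * G ^+ 2 * bb * Num.sqrt n%:R * d%:R.
have [den_gt0|den_le0] := ltP 0 den; last first.
  (* Then eta_max <= 0, and no positive step size is admissible. *)
  exists 1 => // eps eta u T eps_gt0 _ eta_gt0 _ _ eta_max u_max T_min.
  have no_step : ~ eta <= eta_max.
    move=> /(lt_le_trans eta_gt0); rewrite ltNge => /negP; apply.
    by rewrite mulr_ge0_le0 ?invr_le0// ltW.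
  by split=> [/no_step//|etaE]; case: no_step; rewrite etaE.
have [G_gt0 L_gt0 bb_gt0 d_gt0] := nondegenerate_parameters lf den_gt0.
have beta_gt0 := lt_le_trans ltr01 (bbar_sqrt_ge1 bb_gt0).
have [eps0 eps0_gt0 small] := accuracy_threshold B G_gt0 L_gt0 beta_gt0 d_gt0.
exists eps0 => // eps eta u T eps_gt0 /(small _ eps_gt0)[moment start count].
move=> eta_gt0 u_gt0 BT eta_max u_max T_min.
split=> [eta_le u_le T_ge dsp Omega P sigma recv Z xi D tau x run sigma0|].
  by rewrite sigma0 in run; exact: zfo_convergence run.
move=> etaE _ T_eq; have M_gt0 : 0 < M.
  apply: mulr_gt0; last by rewrite lt_max ltr01 orbT.
  by rewrite pmulr_lgt0 ?exprn_gt0// pmulr_lgt0// ltr0n.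
rewrite /c M_gt0; apply: (iteration_count (Bmax_gt0 bb_gt0) BT eps_gt0 count).
rewrite -T_eq /T_min gapE etaE /eta_max -/den /M; congr Num.ceil.
have -> : 6 / (eps / den * eps) = 6 * den / eps ^+ 2 by field; rewrite !gt_eqF.
by rewrite -/bb -/d /den; ring.
Qed.
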